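(* For every fixed $k\ge 2$, the separation problem for inequalities corresponding to alternated minors of $C_n^k$ — given $n\ge k+2$ and $\hat x\in\mathbb{R}^n$, decide whether there is an alternated minor of $C_n^k$ whose minor inequality is violated by $\hat x$ — can be solved in polynomial time.
   Context: $\mathbb{Z}_n=\{0,\dots,n-1\}$ with arithmetic modulo $n$. $C_n^k$ is the $n\times n$ $0,1$ matrix with rows and columns indexed by $\mathbb{Z}_n$ whose $i$-th row is the incidence vector of $\{i,\dots,i+k-1\}\subset\mathbb{Z}_n$. For $N\subset\mathbb{Z}_n$, let $R(N)$ be the set of rows $j$ such that row $j$ of the column-submatrix of $C_n^k$ on columns $\mathbb{Z}_n\setminus N$ entrywise dominates some other row of that submatrix; the minor $C_n^k/N$ is the submatrix with rows $\mathbb{Z}_n\setminus R(N)$ and columns $\mathbb{Z}_n\setminus N$; a circulant minor is one isomorphic (up to row/column permutations) to some $C_{n'}^{k'}$. Let $G(C_n^k)$ be the digraph on $\mathbb{Z}_n$ with arcs $(i,i+k)$ (length $k$) and $(i,i+k+1)$ (length $k+1$). It is known that $C_n^k/N\approx C_{n'}^{k'}$ iff $N$ is the disjoint union of sets $N^0,\dots,N^{d-1}$, each the vertex set of a simple directed cycle of $G(C_n^k)$, all with the same number $n_2$ of arcs of length $k$ and $n_3$ of arcs of length $k+1$, where $n_1n=kn_2+(k+1)n_3$ with $n_1\ge1$, and $n'=n-d(n_2+n_3)$, $k'=k-dn_1$ (the parameters of the minor). With $W^j=\{i\in N^j:i-(k+1)\in N^j\}$ and $W=\bigcup_jW^j$,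 the set $W$ determines $N$ and the minor; $W$ is said to define the minor. The minor is relevant if $n'\not\equiv0\pmod{k'}$ and $\lceil n'/k'\rceil>\lceil n/k\rceil$. For $W$ defining a minor isomorphic to $C_{n'}^{k'}$, its minor inequality is $\sum_{i\in W}2x_i+\sum_{i\notin W}x_i\ge\lceil n'/k'\rceil$. For $W\subset\mathbb{Z}_n$ with $|W|=m$ write $W=\{i_s:s\in\mathbb{Z}_m\}$ with $0\le i_0<\dots<i_{m-1}\le n-1$. A subset $W=\{i_s:s\in\mathbb{Z}_{dn_3}\}$ defining a relevant minor with parameters $d\ge2$, $n_1=1$, $n_2,n_3$ defines a $d$-alternated minor if $W^j=\{i_{j+td}:t\in\mathbb{Z}_{n_3}\}$ for every $j\in\mathbb{Z}_d$. The alternated minors considered here are the $d$-alternated minors ($2\le d\le k-2$) together with the relevant minors with parameters $d=n_1=1$ and $n_3\equiv1\pmod{k-1}$. *)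

(* Defs.v *)
From mathcomp Require Import all_boot all_order all_algebra.
From mathcomp Require Import reals.

Set Implicit Arguments.
Unset Strict Implicit.
Unset Printing Implicit Defensive.

Import Order.TTheory GRing.Theory Num.Theory.

(* Z_n is the type 'I_n, with sums of naturals reduced by %% n. *)

Definition circ (n k : nat) : 'M[nat]_n :=
  \matrix_(i, j) ([exists t : 'I_k, (i + t) %% n == j] : nat).

Section Minors.
Variables (n k : nat).
Implicit Types (N W : {set 'I_n}) (i j l : 'I_n).

(* Row j dominates row l on the columns outside N. *)
Definition row_dominates N j l : bool :=
  [forall (c | c \notin N), circ n k l c <= circ n k j c].

(* The rows deleted when contracting N.  The two inequalities may be equalities
   everywhere: rows i and i+1 of C_n^k coincide outside N as soon as i and i+k
   are in N.  One copy (the one of least index) of each such group has to be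
   kept, as deleting them all would contradict n' = n - d (n2 + n3). *)
Definition deleted_rows N : {set 'I_n} :=
  [set j | [exists l, [&& l != j, row_dominates N j l &
                          row_dominates N l j ==> (l < j)]]].

(* C_n^k / N is isomorphic to C_n'^k'; f and g number its rows and columns. *)
Definition minor_iso N (n' k' : nat) : Prop :=
  exists f g : 'I_n' -> 'I_n,
    [/\ injective f, injective g,
        f @: setT = ~: deleted_rows N, g @: setT = ~: N
      & mxsub f g (circ n k) = circ n' k'].

Definition arc (a : nat) : rel 'I_n := fun i j => (i + a) %% n == j.

(* The digraph G(C_n^k). *)
Definition arcG : rel 'I_n := fun i j => arc k i j || arc k.+1 i j.

(* A simple directed cycle of G(C_n^k), listed by its successive vertices, with
   n2 arcs of length k and n3 arcs of length k+1. *)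
Definition dicycle (n2 n3 : nat) (c : seq 'I_n) : bool :=
  [&& c != [::], ucycleb arcG c,
      count (fun i => arc k i (next c i)) c == n2
    & count (fun i => arc k.+1 i (next c i)) c == n3].

(* { i in M : i - (k+1) in M } *)
Definition long_ends (M : {set 'I_n}) : {set 'I_n} :=
  [set i in M | [exists l in M, arc k.+1 l i]].

(* W defines, through N = N^0 u ... u N^(d-1), a circulant minor with
   parameters d, n1, n2, n3. *)
Definition defines_minor (d n1 n2 n3 : nat) (Nf : 'I_d -> {set 'I_n}) W
    : Prop :=
  [/\ [/\ 0 < d, 0 < n1 & n1 * n = k * n2 + k.+1 * n3],
      forall j : 'I_d, exists2 c, dicycle n2 n3 c & Nf j = [set i in c],
      forall j1 j2 : 'I_d, j1 != j2 -> [disjoint Nf j1 & Nf j2],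
      minor_iso (\bigcup_(j < d) Nf j) (n - d * (n2 + n3)) (k - d * n1)
    & W = \bigcup_(j < d) long_ends (Nf j)].

Definition ceil_div (a b : nat) : nat := a %/ b + ~~ (b %| a).

Definition minor_rhs (d n1 n2 n3 : nat) : nat :=
  ceil_div (n - d * (n2 + n3)) (k - d * n1).

Definition relevant (d n1 n2 n3 : nat) : Prop :=
  ~~ (k - d * n1 %| n - d * (n2 + n3)) /\
  ceil_div n k < minor_rhs d n1 n2 n3.

(* The s-th smallest element of W; enum lists an ordinal set increasingly. *)
Definition elt W (s : nat) : nat := nth 0 [seq val i | i <- enum W] s.

Definition d_alternated (d n2 n3 : nat) W : Prop :=
  exists Nf : 'I_d -> {set 'I_n},
    [/\ 2 <= d, defines_minor 1 n2 n3 Nf W, relevant d 1 n2 n3,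
        #|W| = d * n3
      & forall j : 'I_d,
          long_ends (Nf j) =
          [set i : 'I_n | [exists t : 'I_n3, val i == elt W (j + t * d)]]].

Definition alternated (d n2 n3 : nat) W : Prop :=
  (d <= k - 2 /\ d_alternated d n2 n3 W) \/
  [/\ d = 1, n3 = 1 %[mod k.-1], relevant d 1 n2 n3
    & exists Nf : 'I_d -> {set 'I_n}, defines_minor 1 n2 n3 Nf W].

End Minors.

Local Open Scope ring_scope.

Definition violated (R : realType) (n : nat) (x : 'rV[R]_n) (W : {set 'I_n})
    (rhs : nat) : bool :=
  \sum_(i in W) 2 * x 0 i + \sum_(i | i \notin W) x 0 i < rhs%:R.

Definition violates_alternated_minor (R : realType) (k n : nat)
    (x : 'rV[R]_n) : Prop :=
  exists (d n2 n3 : nat) (W : {set 'I_n}),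
    alternated k d n2 n3 W /\ violated x W (minor_rhs n k d 1 n2 n3).

Local Close Scope ring_scope.

(* Since the input is a real vector, the machine is a random access machine
   with a register file and a memory of natural numbers (also used as
   addresses) and a register file and a memory of real numbers.  Each
   instruction and each test costs 1.  The only arithmetic is addition,
   subtraction (truncated on nat) and comparison: without multiplication,
   unit cost is polynomially equivalent to bit cost.  In t steps a natural
   number gains at most t bits and every real is an integer combination, with
   coefficients of O(t) bits, of the inputs and 1.  So, restricted to rational
   inputs, a number of steps polynomial in n also means polynomial time on a
   Turing machine. *)

Inductive instr : Type :=
| IConst of nat & nat          (* i_a := c              *)
| IAdd   of nat & nat & nat    (* i_a := i_b + i_c      *)
| ISub   of nat & nat & nat    (* i_a := i_b - i_c      *)
| ILoad  of nat & nat          (* i_a := imem[i_b]      *)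
| IStore of nat & nat          (* imem[i_a] := i_b      *)
| RConst of nat & nat          (* r_a := c              *)
| RAdd   of nat & nat & nat    (* r_a := r_b + r_c      *)
| RSub   of nat & nat & nat    (* r_a := r_b - r_c      *)
| RLoad  of nat & nat          (* r_a := rmem[i_b]      *)
| RStore of nat & nat.         (* rmem[i_a] := r_b      *)

Inductive test : Type :=
| ILt of nat & nat             (* i_a < i_b             *)
| RLt of nat & nat.            (* r_a < r_b             *)

Inductive cmd : Type :=
| Do    of instr
| Seq   of cmd & cmd
| If    of test & cmd & cmd
| While of test & cmd.

Record state (R : realType) : Type := State {
  ireg : nat -> nat;
  imem : nat -> nat;
  rreg : nat -> R;
  rmem : nat -> R
}.

Definition upd (T : Type) (f : nat -> T) (a : nat) (v : T) : nat -> T :=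
  fun b => if b == a then v else f b.

Definition step (R : realType) (c : instr) (s : state R) : state R :=
  let: State i mi r mr := s in
  match c with
  | IConst a v => State (upd i a v) mi r mr
  | IAdd a b c => State (upd i a (i b + i c)) mi r mr
  | ISub a b c => State (upd i a (i b - i c)) mi r mr
  | ILoad a b  => State (upd i a (mi (i b))) mi r mr
  | IStore a b => State i (upd mi (i a) (i b)) r mr
  | RConst a v => State i mi (upd r a v%:R%R) mr
  | RAdd a b c => State i mi (upd r a (r b + r c)%R) mr
  | RSub a b c => State i mi (upd r a (r b - r c)%R) mr
  | RLoad a b  => State i mi (upd r a (mr (i b))) mr
  | RStore a b => State i mi r (upd mr (i a) (r b))
  end.

Definition eval (R : realType) (b : test) (s : state R) : bool :=
  match b with
  | ILt a b => ireg s a < ireg s b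
  | RLt a b => (rreg s a < rreg s b)%R
  end.

(* exec c s t s': started in s, c halts in s' after exactly t steps. *)
Inductive exec (R : realType) : cmd -> state R -> nat -> state R -> Prop :=
| exec_do c s : exec (Do c) s 1 (step c s)
| exec_seq c1 c2 s s1 s2 t1 t2 :
    exec c1 s t1 s1 -> exec c2 s1 t2 s2 -> exec (Seq c1 c2) s (t1 + t2) s2
| exec_if b c1 c2 s s1 t :
    exec (if eval b s then c1 else c2) s t s1 -> exec (If b c1 c2) s t.+1 s1
| exec_while_true b c s s1 s2 t1 t2 :
    eval b s -> exec c s t1 s1 -> exec (While b c) s1 t2 s2 ->
    exec (While b c) s (t1 + t2).+1 s2
| exec_while_false b c s :
    ~~ eval b s -> exec (While b c) s 1 s.

(* n in i_0 and x in the first n cells of the real memory, 0 elsewhere. *)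
Definition init (R : realType) (n : nat) (x : 'rV[R]_n) : state R :=
  State (upd (fun=> 0) 0 n) (fun=> 0) (fun=> 0%R)
        (fun a => if insub a is Some j then x 0%R j else 0%R).

(* A single program and a single polynomial work for all n >= n0 and all x;
   the answer is "yes" when i_0 = 1 on halting. *)
Definition decidable_in_poly_time (R : realType) (n0 : nat)
    (P : forall n : nat, 'rV[R]_n -> Prop) : Prop :=
  exists (c : cmd) (p : {poly nat}),
    forall (n : nat) (x : 'rV[R]_n), n0 <= n ->
      exists (t : nat) (s : state R),
        [/\ exec c (init x) t s, t <= p.[n]%R & ireg s 0 = 1 <-> P n x].

(* Main.v *)
From mathcomp Require Import all_boot all_order all_algebra reals zify.
Require Import Defs.

(* With n1 = 1, a cycle of G(C_n^k) with arcs of total length n winds once around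
   Z_n, so its vertex set is an n-periodic subset of the naturals that meets every
   window of length k at most once and every window of length k+1 at least once.
   Conversely d disjoint such sets always define a minor: a window of length k
   meets the complement of their union in k-d or k-d+1 points, and the minimal
   windows form C_n'^k'.  Since n = k (n2 + n3) + n3, the right-hand side is
   n2 + n3 + ceil(n3 / (k - d)), and relevance only depends on d and n3.

   All conditions are therefore local along Z_n: scanning the positions, it is
   enough to remember d, the distance back to the last vertex of each cycle, the
   number of elements of W modulo d and the number of elements of W^0 up to an
   eventually periodic identification, that is, a state in a finite set that does
   not depend on n.  The right-hand side too is a sum of local contributions.
   Hence a violated alternated minor is a walk of length n and negative weight in
   a fixed weighted digraph, with matching end states; a shortest-walk recursion
   finds one in a linear number of steps. *)

Set Implicit Arguments.
Unset Strict Implicit.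
Unset Printing Implicit Defensive.

Import Order.TTheory GRing.Theory Num.Theory.

(** * Minimum-weight walks on the random access machine *)

Section LoopFree.
Variable R : realType.

Fixpoint loop_free (c : cmd) : bool :=
  match c with
  | Do _ => true
  | Seq c1 c2 | If _ c1 c2 => loop_free c1 && loop_free c2
  | While _ _ => false
  end.

Fixpoint cmd_size (c : cmd) : nat :=
  match c with
  | Do _ => 1
  | Seq c1 c2 | If _ c1 c2 => (cmd_size c1 + cmd_size c2).+1
  | While _ c1 => (cmd_size c1).+1
  end.

(** Meaningful for loop-free commands only; the value at [While] is a dummy. *)
Fixpoint sem (c : cmd) (s : state R) : state R :=
  match c with
  | Do i => step i s
  | Seq c1 c2 => sem c2 (sem c1 s)
  | If b c1 c2 => if eval b s then sem c1 s else sem c2 s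
  | While _ _ => s
  end.

Lemma exec_loop_free c s :
  loop_free c -> exists2 t, t <= cmd_size c & exec c s t (sem c s).
Proof.
elim: c s => [i|c1 IH1 c2 IH2|b c1 IH1 c2 IH2|//] s /=.
- by exists 1 => //; apply: exec_do.
- case/andP=> /(IH1 s)[t1 le1 ex1] /(IH2 (sem c1 s))[t2 le2 ex2].
  exists (t1 + t2); last exact: exec_seq ex1 ex2.
  by rewrite (leq_trans (leq_add le1 le2)).
- case/andP=> /(IH1 s)[t1 le1 ex1] /(IH2 s)[t2 le2 ex2].
  case E: (eval b s).
    exists t1.+1; first by rewrite ltnS (leq_trans le1) ?leq_addr.
    by apply: exec_if; rewrite E.
  exists t2.+1; first by rewrite ltnS (leq_trans le2) ?leq_addl.
  by apply: exec_if; rewrite E.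
Qed.

(* Register 3 is kept at 0 by all programs below. *)
Definition nop : cmd := Do (IConst 3 0).

Definition block (cs : seq cmd) : cmd := foldr Seq nop cs.

Lemma loop_free_block cs : all loop_free cs -> loop_free (block cs).
Proof. by elim: cs => //= c cs IH /andP[-> /IH]. Qed.

End LoopFree.

Section Walk.
Variables (R : realType) (Q : finType) (tr acc : rel Q) (a c : Q -> Q -> nat).

(** Each pair (start, current state) owns an even index for the current layer and the next odd one
    for the new layer, in both register files: the integer is a reachability flag, the real the
    least weight. Indices below 4 are reserved: n, the position, 1 and 0 among the integers; x_p, a
    scratch value, 1 and 0 among the reals. *)
Definition cur_reg (e : Q * Q) : nat := (enum_rank e).*2 + 4.
Definition new_reg (e : Q * Q) : nat := (enum_rank e).*2 + 5.

(** The coefficients are constants of the program, so multiplying by them is unrolled into repeated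
    additions. As register 3 holds 0, comparing with it tests a flag and adding it copies a
    value. *)
Definition relax_cmd (e : Q * Q * Q) : cmd :=
  let: (q0, q, q') := e in
  let set := Seq (Do (RAdd (new_reg (q0, q')) 1 3))
                 (Do (IConst (new_reg (q0, q')) 1)) in
  If (ILt 3 (cur_reg (q0, q)))
    (Seq (Do (RAdd 1 (cur_reg (q0, q)) 3))
    (Seq (iter (a q q') (fun p => Seq p (Do (RAdd 1 1 0))) nop)
    (Seq (iter (c q q') (fun p => Seq p (Do (RSub 1 1 2))) nop)
         (If (ILt 3 (new_reg (q0, q')))
            (If (RLt 1 (new_reg (q0, q'))) set nop) set))))
    nop.

Definition clear_cmd (e : Q * Q) : cmd := Do (IConst (new_reg e) 0).

Definition copy_cmd (e : Q * Q) : cmd :=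
  Seq (Do (IAdd (cur_reg e) (new_reg e) 3)) (Do (RAdd (cur_reg e) (new_reg e) 3)).

Definition edges : seq (Q * Q * Q) :=
  [seq e <- enum {: Q * Q * Q} | tr e.1.2 e.2].

Definition body_cmd : cmd :=
  Seq (Do (RLoad 0 1))
  (Seq (block [seq clear_cmd e | e <- enum {: Q * Q}])
  (Seq (block [seq relax_cmd e | e <- edges])
  (Seq (block [seq copy_cmd e | e <- enum {: Q * Q}])
       (Do (IAdd 1 1 2))))).

Definition start_cmd : cmd :=
  Seq (Do (IConst 2 1))
  (Seq (Do (RConst 2 1))
       (block [seq Do (IConst (cur_reg (q, q)) 1) | q <- enum Q])).

Definition final_cmd : cmd :=
  Seq (Do (IConst 0 0))
  (block [seq If (ILt 3 (cur_reg e)) (If (RLt (cur_reg e) 3) (Do (IConst 0 1)) nop) nop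
         | e <- enum {: Q * Q} & acc e.1 e.2]).

Definition walk_cmd : cmd :=
  Seq start_cmd (Seq (While (ILt 1 0) body_cmd) final_cmd).

Lemma cur_reg_inj : injective cur_reg.
Proof. by move=> e f /addIn/double_inj/ord_inj/enum_rank_inj. Qed.

Lemma new_reg_inj : injective new_reg.
Proof. by move=> e f /addIn/double_inj/ord_inj/enum_rank_inj. Qed.

Lemma cur_new e f : (cur_reg e == new_reg f) = false.
Proof.
apply/negbTE/eqP=> /(congr1 odd).
by rewrite /cur_reg /new_reg !oddD !odd_double.
Qed.

Lemma new_cur e f : (new_reg e == cur_reg f) = false.
Proof. by rewrite eq_sym cur_new. Qed.

Lemma loop_free_iter m (i : instr) :
  loop_free (iter m (fun p => Seq p (Do i)) nop).
Proof. by elim: m => //= m ->. Qed.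

Lemma loop_free_body : loop_free body_cmd.
Proof.
rewrite /= !loop_free_block // all_map; try exact/allP.
by apply/allP=> -[[q0 q] q'] _ /=; rewrite !loop_free_iter.
Qed.

Lemma loop_free_start : loop_free start_cmd.
Proof. by rewrite /= loop_free_block // all_map; apply/allP. Qed.

Lemma loop_free_final : loop_free final_cmd.
Proof. by rewrite /= loop_free_block // all_map; apply/allP. Qed.

(** * Correctness of the dynamic program *)

Local Open Scope ring_scope.
Implicit Types (s : state R) (X : nat -> R).

Definition step_cost X p q q' : R := X p *+ a q q' - (c q q')%:R.

Fixpoint reach X p q0 q (r : R) : Prop :=
  if p is p'.+1 then
    exists q1 r1, [/\ reach X p' q0 q1 r1, tr q1 q & r = r1 + step_cost X p' q1 q]
  else q0 = q /\ r = 0.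

Definition on s (g : nat) : bool := (0 < ireg s g)%N.

Definition fixed_regs s s' : Prop :=
  [/\ forall i, (i < 4)%N -> ireg s' i = ireg s i,
      rreg s' 0 = rreg s 0, rreg s' 2 = rreg s 2, rreg s' 3 = rreg s 3
    & rmem s' = rmem s].

Definition good_regs X n p s : Prop :=
  [/\ [/\ ireg s 0 = n, ireg s 1 = p, ireg s 2 = 1%N & ireg s 3 = 0%N],
      rreg s 2 = 1, rreg s 3 = 0 & rmem s = X].

(** The invariant of the dynamic program: the flag of a pair tells whether some weight satisfies
    [C], and the real register then holds the least one. *)
Definition best s (reg : Q * Q -> nat) (C : Q -> Q -> R -> Prop) : Prop :=
  forall q0 q,
    (on s (reg (q0, q)) -> C q0 q (rreg s (reg (q0, q)))) /\
    (forall r, C q0 q r ->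
       on s (reg (q0, q)) /\ rreg s (reg (q0, q)) <= r).

Lemma fixed_refl s : fixed_regs s s.
Proof. by []. Qed.

Lemma fixed_trans s1 s2 s3 :
  fixed_regs s1 s2 -> fixed_regs s2 s3 -> fixed_regs s1 s3.
Proof.
case=> i1 a1 b1 c1 m1 [i2 a2 b2 c2 m2].
by split; rewrite ?a2 ?b2 ?c2 ?m2 // => i lt_i; rewrite i2 ?i1.
Qed.

Lemma fixed_good X n p s s' :
  fixed_regs s s' -> good_regs X n p s -> good_regs X n p s'.
Proof. by case=> i _ r2 r3 m [[n0 n1 n2 n3] e2 e3 em]; split; rewrite ?r2 ?r3 ?m ?i. Qed.


Definition same_on (g : Q * Q -> nat) s s' : Prop :=
  forall e, ireg s' (g e) = ireg s (g e) /\ rreg s' (g e) = rreg s (g e).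

Lemma same_on_trans g s1 s2 s3 :
  same_on g s1 s2 -> same_on g s2 s3 -> same_on g s1 s3.
Proof. by move=> h1 h2 e; case: (h1 e) (h2 e) => <- <- [-> ->]. Qed.

Lemma best_same g s s' C : same_on g s s' -> best s g C -> best s' g C.
Proof. by move=> h b q0 q; rewrite /on; case: (h (q0, q)) => -> ->; apply: b. Qed.

(** Integer registers are compared pointwise, because [nop] overwrites register 3 with the 0 it
    already holds. *)
Definition but1 s s' : Prop :=
  [/\ ireg s' =1 ireg s, forall r, r != 1%N -> rreg s' r = rreg s r
    & rmem s' = rmem s].


Lemma step_iconst s g v :
  (ireg (step (IConst g v) s) = upd (ireg s) g v) *
  (rreg (step (IConst g v) s) = rreg s) * (rmem (step (IConst g v) s) = rmem s).
Proof. by case: s. Qed.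

Lemma step_iadd s g h l :
  (ireg (step (IAdd g h l) s) = upd (ireg s) g (ireg s h + ireg s l)%N) *
  (rreg (step (IAdd g h l) s) = rreg s) * (rmem (step (IAdd g h l) s) = rmem s).
Proof. by case: s. Qed.

Lemma step_rconst s g v :
  (ireg (step (RConst g v) s) = ireg s) *
  (rreg (step (RConst g v) s) = upd (rreg s) g v%:R) *
  (rmem (step (RConst g v) s) = rmem s).
Proof. by case: s. Qed.

Lemma step_radd s g h l :
  (ireg (step (RAdd g h l) s) = ireg s) *
  (rreg (step (RAdd g h l) s) = upd (rreg s) g (rreg s h + rreg s l)) *
  (rmem (step (RAdd g h l) s) = rmem s).
Proof. by case: s. Qed.

Lemma step_rsub s g h l :
  (ireg (step (RSub g h l) s) = ireg s) *
  (rreg (step (RSub g h l) s) = upd (rreg s) g (rreg s h - rreg s l)) *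
  (rmem (step (RSub g h l) s) = rmem s).
Proof. by case: s. Qed.

Lemma step_rload s g h :
  (ireg (step (RLoad g h) s) = ireg s) *
  (rreg (step (RLoad g h) s) = upd (rreg s) g (rmem s (ireg s h))) *
  (rmem (step (RLoad g h) s) = rmem s).
Proof. by case: s. Qed.

Definition stepE :=
  (step_iconst, step_iadd, step_rconst, step_radd, step_rsub, step_rload).

Lemma sem_nop s : ireg s 3 = 0%N -> but1 s (sem nop s) /\ rreg (sem nop s) = rreg s.
Proof.
move=> i3; rewrite /= /but1 !stepE; do 2!split=> //.
by move=> b; rewrite /upd; case: eqP => // ->.
Qed.

Lemma but1_trans s1 s2 s3 : but1 s1 s2 -> but1 s2 s3 -> but1 s1 s3.
Proof.
case=> i1 r1 m1 [i2 r2 m2]; split; rewrite ?m2 //.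
  by move=> b; rewrite i2 i1.
by move=> b b1; rewrite r2 ?r1.
Qed.

Lemma but1_radd s h l : but1 s (step (RAdd 1 h l) s).
Proof. by rewrite /but1 !stepE; split=> // b /negbTE b1; rewrite /upd b1. Qed.

Lemma but1_rsub s h l : but1 s (step (RSub 1 h l) s).
Proof. by rewrite /but1 !stepE; split=> // b /negbTE b1; rewrite /upd b1. Qed.

Lemma sem_iter_add s m : ireg s 3 = 0%N ->
  let s' := sem (iter m (fun p => Seq p (Do (RAdd 1 1 0))) nop) s in
  but1 s s' /\ rreg s' 1 = rreg s 1 + rreg s 0 *+ m.
Proof.
move=> i3; elim: m => [|m]; first by case: (sem_nop i3) => h /= ->; rewrite addr0.
rewrite iterS [sem (Seq _ _) _]/=; set s1 := sem _ s => -[h e].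
split; first by apply: but1_trans h _; apply: but1_radd.
have r0 : rreg s1 0 = rreg s 0 by case: h => _ ->.
by rewrite stepE /upd /= e r0 mulrS (addrC (rreg s 0)) addrA.
Qed.

Lemma sem_iter_sub s m : ireg s 3 = 0%N -> rreg s 2 = 1 ->
  let s' := sem (iter m (fun p => Seq p (Do (RSub 1 1 2))) nop) s in
  but1 s s' /\ rreg s' 1 = rreg s 1 - m%:R.
Proof.
move=> i3 r2; elim: m => [|m]; first by case: (sem_nop i3) => h /= ->; rewrite subr0.
rewrite iterS [sem (Seq _ _) _]/=; set s1 := sem _ s => -[h e].
split; first by apply: but1_trans h _; apply: but1_rsub.
have e2 : rreg s1 2 = 1 by case: h => _ ->.
by rewrite stepE /upd /= e e2 -natr1 opprD addrA.
Qed.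

Lemma cur_reg_gt3 e i : (i < 4)%N -> (cur_reg e == i) = false.
Proof. by move=> lt_i; rewrite gtn_eqF // (leq_trans lt_i) // leq_addl. Qed.

Lemma new_reg_gt3 e i : (i < 4)%N -> (new_reg e == i) = false.
Proof. by move=> lt_i; rewrite gtn_eqF // (leq_trans lt_i) // (leq_trans _ (leq_addl _ _)). Qed.

Lemma but1_fixed s s' : but1 s s' ->
  [/\ fixed_regs s s', same_on cur_reg s s' & same_on new_reg s s'].
Proof.
case=> i r m; split; first by split=> // *; rewrite ?i ?r.
  by move=> e; rewrite i r // cur_reg_gt3.
by move=> e; rewrite i r // new_reg_gt3.
Qed.

Lemma relax_spec s q0 q q' : ireg s 3 = 0%N -> rreg s 2 = 1 -> rreg s 3 = 0 ->
  let s' := sem (relax_cmd (q0, q, q')) s in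
  let r := rreg s (cur_reg (q0, q)) + (rreg s 0 *+ a q q' - (c q q')%:R) in
  let e := (q0, q') in
  [/\ fixed_regs s s', same_on cur_reg s s',
      forall f, f != e ->
        ireg s' (new_reg f) = ireg s (new_reg f) /\
        rreg s' (new_reg f) = rreg s (new_reg f)
    & if on s (cur_reg (q0, q)) then
        on s' (new_reg e) /\
        rreg s' (new_reg e) =
          (if on s (new_reg e) && ~~ (r < rreg s (new_reg e))
           then rreg s (new_reg e) else r)
      else ireg s' (new_reg e) = ireg s (new_reg e) /\
           rreg s' (new_reg e) = rreg s (new_reg e)].
Proof.
move=> i3 r2 r3; rewrite /on.
pose s1 : state R := step (RAdd 1 (cur_reg (q0, q)) 3) s.
have b1 : but1 s s1 by apply: but1_radd.
have v1 : rreg s1 1 = rreg s (cur_reg (q0, q)).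
  by rewrite /s1 stepE /upd /= r3 addr0.
have i31 : ireg s1 3 = 0%N by case: b1 => ->.
have := sem_iter_add (a q q') i31; set s2 := sem _ s1 => -[b2 v2].
have i32 : ireg s2 3 = 0%N by case: b2 => ->.
have r22 : rreg s2 2 = 1 by case: b2 => _ ->//; case: b1 => _ ->.
have := sem_iter_sub (c q q') i32 r22; set s3 := sem _ s2 => -[b3 v3].
have b : but1 s s3 by apply: but1_trans b3; apply: but1_trans b2.
have r01 : rreg s1 0 = rreg s 0 by case: b1 => _ ->.
rewrite v2 v1 r01 -addrA in v3.
have i33 : ireg s3 3 = 0%N by case: b => ->.
have r33 : rreg s3 3 = 0 by case: b => _ ->.
rewrite [sem _ _]/= i3 -/s1 -/s2 -/s3.
case: ifP => on1; last first.
  have [bn _] := sem_nop i3.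
  have [f1 f2 f3] := but1_fixed bn.
  by rewrite [sem nop s]/= in f1 f2 f3; split=> // *; apply: f3.
have [f1 f2 f3] := but1_fixed b.
have [in_e rn_e] := f3 (q0, q').
(* The branch that stores the candidate is reached twice: on an empty register and on an
   improvement. *)
have setP : let s' := step (IConst (new_reg (q0, q')) 1)
                        (step (RAdd (new_reg (q0, q')) 1 3) s3) in
  [/\ fixed_regs s s', same_on cur_reg s s',
      forall f, f != (q0, q') ->
        ireg s' (new_reg f) = ireg s (new_reg f) /\
        rreg s' (new_reg f) = rreg s (new_reg f)
    & on s' (new_reg (q0, q')) /\ rreg s' (new_reg (q0, q')) = rreg s3 1].
  rewrite /on /=; split.
  - apply: fixed_trans f1 _; rewrite /fixed_regs !stepE /upd.
    by split=> // [i lt_i||| ]; rewrite eq_sym new_reg_gt3.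
  - apply: same_on_trans f2 _ => e; rewrite !stepE /upd cur_new; split=> //.
  - move=> f /negbTE ne; rewrite !stepE /upd (inj_eq new_reg_inj) ne.
    exact: f3.
  - by rewrite !stepE /upd eqxx r33 addr0.
rewrite i33 in_e v3 rn_e.
set r := rreg s _ + _ in v3 *.
have [g1 g2 g3 [g4 g5]] := setP; rewrite v3 in g5.
case: ifP => on2 /=; last by split.
case: ifP => lt_r; first by split.
have [bn rn] := sem_nop i33.
have [h1 h2 h3] := but1_fixed bn.
rewrite /= in h1 h2 h3.
split.
- exact: fixed_trans f1 h1.
- exact: same_on_trans f2 h2.
- by move=> f _; case: (h3 f) (f3 f) => -> -> [].
- by case: (h3 (q0, q')) => -> ->; rewrite in_e.
Qed.


(** The second alternative covers the pairs treated earlier, which makes the induction on [l]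
    work. *)
Lemma clear_spec l s : ireg s 3 = 0%N ->
  let s' := sem (block [seq clear_cmd e | e <- l]) s in
  [/\ fixed_regs s s', same_on cur_reg s s'
    & forall e, e \in l \/ on s (new_reg e) = false -> on s' (new_reg e) = false].
Proof.
elim: l s => [|f l IH] s i3.
  have [/but1_fixed[f1 f2 f3] _] := sem_nop i3.
  by split=> // e [] // h; rewrite /on; case: (f3 e) => -> _.
rewrite /=; set s1 := step _ s.
have f1 : fixed_regs s s1.
  rewrite /s1 /fixed_regs !stepE /upd; split=> // i lt_i.
  by rewrite eq_sym new_reg_gt3.
have [|g1 g2 g3] := IH s1; first by case: f1 => ->.
split; first exact: fixed_trans f1 g1.
  by apply: same_on_trans g2 => e; rewrite /s1 !stepE /upd cur_new.
move=> e e_l; apply: g3; rewrite /on /s1 stepE /upd (inj_eq new_reg_inj).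
by case: e_l; rewrite ?inE => h; case: eqP h => //=; auto.
Qed.

Lemma copy_spec l s : ireg s 3 = 0%N -> rreg s 3 = 0 ->
  let s' := sem (block [seq copy_cmd e | e <- l]) s in
  [/\ fixed_regs s s', same_on new_reg s s'
    & forall e,
        e \in l \/ ireg s (cur_reg e) = ireg s (new_reg e) /\
                   rreg s (cur_reg e) = rreg s (new_reg e) ->
        ireg s' (cur_reg e) = ireg s (new_reg e) /\
        rreg s' (cur_reg e) = rreg s (new_reg e)].
Proof.
elim: l s => [|f l IH] s i3 r3.
  have [/but1_fixed[f1 f2 f3] _] := sem_nop i3.
  by split=> // e [] // [h1 h2]; case: (f2 e) => -> ->.
rewrite /=; set s1 := step _ (step _ s).
have f1 : fixed_regs s s1.
  rewrite /s1 /fixed_regs !stepE /upd.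
  by split=> // [i lt_i||| ]; rewrite eq_sym cur_reg_gt3.
have f2 : same_on new_reg s s1.
  by move=> e; rewrite /s1 !stepE /upd new_cur.
have [||g1 g2 g3] := IH s1; [by case: f1 => -> | by case: f1 => _ _ _ -> | ].
split; [exact: fixed_trans f1 g1 | exact: same_on_trans f2 g2 | ].
move=> e e_l; case: (f2 e) => <- <-; apply: g3.
case: (f2 e) => -> ->; rewrite /s1 !stepE /upd (inj_eq cur_reg_inj).
case: e_l; rewrite ?inE; case: eqP => [->|_] /=; rewrite ?i3 ?r3 ?addn0 ?addr0; auto.
Qed.

(** All candidates are evaluated in the state before the relaxations, since these write only to the
    new layer and to the scratch register. *)
Definition cand s (l : seq (Q * Q * Q)) q0 q' (r : R) : Prop :=
  exists2 q, (q0, q, q') \in l &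
    on s (cur_reg (q0, q)) /\
    r = rreg s (cur_reg (q0, q)) + (rreg s 0 *+ a q q' - (c q q')%:R).

Lemma relax_block_spec s0 l l0 s :
  ireg s0 3 = 0%N -> rreg s0 2 = 1 -> rreg s0 3 = 0 ->
  fixed_regs s0 s -> same_on cur_reg s0 s -> best s new_reg (cand s0 l0) ->
  let s' := sem (block [seq relax_cmd e | e <- l]) s in
  [/\ fixed_regs s0 s', same_on cur_reg s0 s'
    & best s' new_reg (cand s0 (l0 ++ l))].
Proof.
move=> i3 r2 r3; elim: l l0 s => [|[[q0 q] q'] l IH] l0 s fix0 same0 best0 /=.
  have [|/but1_fixed[f1 f2 f3] _] := @sem_nop s; first by case: fix0 => ->.
  rewrite /= in f1 f2 f3; rewrite cats0.
  split; [exact: fixed_trans f1|exact: same_on_trans f2|exact: best_same f3 _].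
have e3 : ireg s 3 = 0%N by case: fix0 => ->.
have [d0 d2 d3] : [/\ rreg s 0 = rreg s0 0, rreg s 2 = 1 & rreg s 3 = 0].
  by case: fix0 => _ -> -> ->.
have := @relax_spec s q0 q q' e3 d2 d3; set s1 := sem _ s; cbv zeta.
set r := _ + _ => -[f1 f2 f3 f4].
rewrite -cat_rcons; apply: IH.
- exact: fixed_trans f1.
- exact: same_on_trans f2.
have r_cand l1 : (q0, q, q') \in l1 -> on s (cur_reg (q0, q)) ->
    cand s0 l1 q0 q' r.
  move=> in_l; rewrite /on; case: (same0 (q0, q)) => h1 h2.
  by rewrite h1 => on_c; exists q => //; rewrite /r h2 d0.
have mono p0 p r' : cand s0 l0 p0 p r' -> cand s0 (rcons l0 (q0, q, q')) p0 p r'.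
  by case=> z z_l h; exists z => //; rewrite mem_rcons inE z_l orbT.
move=> p0 p; case: (eqVneq (p0, p) (q0, q')) => [[-> ->]|ne].
  case: (best0 q0 q') => B1 B2.
  move: f4; case: ifP => on_c f4; last first.
    move: f4.
    case=> h1 h2; rewrite /on h1 h2; split=> [/B1/mono//|r' [z]].
    rewrite mem_rcons inE => /orP[/eqP[->]|z_l] z_on; last by apply: B2; exists z.
    by move: on_c z_on; rewrite /on; case: (same0 (q0, q)) => -> _ -> [].
  case: f4 => on1 ->; split.
    move=> _; case: ifP => [/andP[/B1/mono]//|_].
    by apply: r_cand; rewrite // mem_rcons mem_head.
  move=> r' [z]; rewrite mem_rcons inE => /orP[/eqP[->]|z_l] [z_on r'E].
    split=> //; have <- : r = r' by rewrite r'E /r d0; case: (same0 (q0, q)) => _ ->.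
    by case: ifP => // /andP[_]; rewrite -leNgt.
  have [on_n le_n] : on s (new_reg (q0, q')) /\ rreg s (new_reg (q0, q')) <= r'.
    by apply: B2; exists z.
  split=> //; rewrite on_n; case: ifP => //= /negbFE /ltW lt_r.
  exact: le_trans lt_r le_n.
have [h1 h2] := f3 _ ne.
rewrite /on h1 h2; case: (best0 p0 p) => B1 B2; split=> [/B1/mono//|r' [z]].
rewrite mem_rcons inE => /orP[/eqP[E1 _ E2]|z_l] z_on; last by apply: B2; exists z.
by rewrite E1 E2 eqxx in ne.
Qed.

(** Bellman's principle: a walk of length p + 1 extends one of length p, and replacing that prefix
    by a lightest one with the same ends does not increase the weight. *)
Lemma body_spec X n p s :
  good_regs X n p s -> best s cur_reg (reach X p) ->
  let s' := sem body_cmd s in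
  good_regs X n p.+1 s' /\ best s' cur_reg (reach X p.+1).
Proof.
move=> good0 best0.
rewrite [sem _ _]/=; set s1 := step (RLoad 0 1) s.
have [[i0 i1 i2 i3] r2 r3 m] := good0.
have good1 : good_regs X n p s1 by rewrite /s1 /good_regs !stepE /upd /=.
have x1 : rreg s1 0 = X p by rewrite /s1 stepE /upd /= m i1.
have same1 : same_on cur_reg s s1.
  by move=> e; rewrite /s1 !stepE /upd cur_reg_gt3.
have [|f2 c2 n2] := @clear_spec (enum {: Q * Q}) s1; first by case: good1 => -[].
set s2 := sem _ s1 in f2 c2 n2 *.
have good2 := fixed_good f2 good1.
have best2 : best s2 cur_reg (reach X p).
  exact: best_same c2 (best_same same1 best0).
have x2 : rreg s2 0 = X p by case: f2 => _ ->.
have best_new2 : best s2 new_reg (cand s2 [::]).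
  by move=> q0 q; rewrite n2; [split=> // r [] | left; rewrite mem_enum].
have [[_ _ _ i23] r22 r23 _] := good2.
have := @relax_block_spec s2 edges [::] s2 i23 r22 r23 (fixed_refl _)
  (fun e => conj erefl erefl) best_new2.
cbv zeta; set s3 := sem _ s2 => -[f3 c3 best3].
have good3 := fixed_good f3 good2.
have [[_ _ _ i33] r32 r33 _] := good3.
have := @copy_spec (enum {: Q * Q}) s3 i33 r33.
cbv zeta; set s4 := sem _ s3 => -[f4 n4 c4].
have [[i40 i41 i42 i43] r42 r43 m4] := fixed_good f4 good3.
split.
  by rewrite /good_regs !stepE /upd /= i41 i42 addn1.
move=> q0 q; rewrite /on !stepE /upd cur_reg_gt3 //.
have [|-> ->] := c4 (q0, q); first by left; rewrite mem_enum.
have [B1 B2] := best3 q0 q; split.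
  move=> /B1[q1]; rewrite mem_filter mem_enum andbT /= => tr1 [on1 ->].
  exists q1, (rreg s2 (cur_reg (q0, q1))); rewrite x2; split=> //.
  by case: (best2 q0 q1) => + _; apply.
move=> r [q1 [r1 [h1 tr1 ->]]].
have [_ /(_ _ h1)[on1 le1]] := best2 q0 q1.
have [|on_n le_n] := B2 (rreg s2 (cur_reg (q0, q1)) + step_cost X p q1 q).
  exists q1; first by rewrite mem_filter mem_enum andbT.
  by rewrite x2.
by split=> //; apply: le_trans le_n _; rewrite lerD2r.
Qed.

Lemma start_spec n (x : 'rV[R]_n) :
  let s := sem start_cmd (init x) in
  good_regs (rmem (init x)) n 0 s /\ best s cur_reg (reach (rmem (init x)) 0).
Proof.
pose P (l : seq Q) s :=
  [/\ good_regs (rmem (init x)) n 0 s, forall e, rreg s (cur_reg e) = 0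
    & forall e, on s (cur_reg e) = (e.1 == e.2) && (e.1 \in l)].
suff H l1 l2 s : P l1 s ->
    P (l1 ++ l2) (sem (block [seq Do (IConst (cur_reg (q, q)) 1) | q <- l2]) s).
  have := H [::] (enum Q) (step (RConst 2 1) (step (IConst 2 1) (init x))).
  case.
    split=> [|e|e]; rewrite /good_regs /on ?stepE //=.
      by rewrite /upd cur_reg_gt3.
    by rewrite /upd !cur_reg_gt3 // andbF.
  move=> h1 h2 h3; split=> // q0 q; rewrite h2 h3 mem_enum andbT /=.
  by split=> [/eqP|r [-> ->]]; rewrite ?eqxx.
elim: l2 l1 s => [|f l2 IH] l1 s [g1 g2 g3]; rewrite ?cats0.
  case: (g1) => -[_ _ _ i3] _ _ _.
  have [/but1_fixed[f1 f2 _] _] := sem_nop i3.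
  split; first exact: fixed_good f1 g1.
    by move=> e; case: (f2 e) => _ ->.
  by move=> e; rewrite /on; case: (f2 e) => -> _; apply: g3.
rewrite -cat_rcons /=; apply: IH; split.
- case: g1 => -[i0 i1 i2 i3] r2 r3 m; rewrite /good_regs !stepE /upd.
  by rewrite ![_ == cur_reg _]eq_sym !cur_reg_gt3.
- by move=> e; rewrite stepE.
move=> [q0 q]; move: (g3 (q0, q)).
rewrite /on stepE /upd (inj_eq cur_reg_inj) mem_rcons inE xpair_eqE /= => E.
case: (eqVneq q0 f) E => [->|_] //=.
by case: (eqVneq q f) => [->|/negbTE ne] //= ->; rewrite ?eqxx // eq_sym ne.
Qed.

Lemma final_spec X n s :
  good_regs X n n s -> best s cur_reg (reach X n) ->
  ireg (sem final_cmd s) 0 = 1%N <->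
  exists q0 q r, [/\ acc q0 q, reach X n q0 q r & r < 0].
Proof.
move=> good0 best0; rewrite [sem _ _]/=; set s0 := step _ s.
pose yes e s := on s (cur_reg e) && (rreg s (cur_reg e) < 0).
suff H l s1 : ireg s1 3 = 0%N -> rreg s1 3 = 0 -> (ireg s1 0 <= 1)%N ->
    ireg (sem (block [seq If (ILt 3 (cur_reg e)) (If (RLt (cur_reg e) 3)
                         (Do (IConst 0 1)) nop) nop | e <- l]) s1) 0 =
    (ireg s1 0 == 1%N) || has (yes^~ s1) l :> nat.
  have [[i0 i1 i2 i3] r2 r3 m] := good0.
  rewrite H /s0 ?stepE /upd //=.
  have same0 : same_on cur_reg s s0.
    by move=> e; rewrite /s0 !stepE /upd cur_reg_gt3.
  have best1 := best_same same0 best0.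
  rewrite (_ : (nat_of_bool _ = 1)%N <->
    has (yes^~ s0) [seq e <- enum {: Q * Q} | acc e.1 e.2]); last first.
    by rewrite -/s0; case: has.
  split.
    case/hasP=> -[q0 q]; rewrite mem_filter => /andP[acc_e _] /andP[on_e lt_e].
    exists q0, q, (rreg s0 (cur_reg (q0, q))); split=> //.
    by case: (best1 q0 q) => + _; apply.
  case=> q0 [q [r [acc_e /(proj2 (best1 q0 q)) [on_e le_e] lt_r]]].
  apply/hasP; exists (q0, q); first by rewrite mem_filter mem_enum acc_e.
  by rewrite /yes on_e (le_lt_trans le_e).
elim: l s1 => [|e l IH] s1 i3 r3 le1 /=.
  by rewrite stepE /upd /= orbF; case: (ireg s1 0) le1 => [|[]].
have nopP : let s' := sem nop s1 in
   [/\ ireg s' 3 = 0%N, rreg s' 3 = 0, ireg s' 0 = ireg s1 0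
     & forall e, yes e s' = yes e s1].
  have [/but1_fixed[f1 f2 _] _] := sem_nop i3.
  case: f1 => h1 _ _ h2 _; split; rewrite ?h1 ?h2 // => f.
  by rewrite /yes /on; case: (f2 f) => -> ->.
have nop_case : yes e s1 = false ->
   ireg (sem (block [seq If (ILt 3 (cur_reg e)) (If (RLt (cur_reg e) 3)
                         (Do (IConst 0 1)) nop) nop | e <- l]) (sem nop s1)) 0 =
    (ireg s1 0 == 1%N) || (yes e s1 || has (yes^~ s1) l) :> nat.
  case: nopP => h1 h2 h3 h4 ->; rewrite IH ?h3 //.
  by congr nat_of_bool; congr orb; apply: eq_has => f; rewrite h4.
rewrite i3 r3; case: ifP => on_e; last by apply: nop_case; rewrite /yes /on on_e.
case: ifP => lt_e; last by apply: nop_case; rewrite /yes lt_e andbF.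
by rewrite IH ?stepE /upd //= /yes /on on_e lt_e orbT.
Qed.

Lemma while_spec X n p s : (p <= n)%N ->
  good_regs X n p s -> best s cur_reg (reach X p) ->
  exists t s', [/\ exec (While (ILt 1 0) body_cmd) s t s',
    (t <= (cmd_size body_cmd).+1 * (n - p) + 1)%N,
    good_regs X n n s' & best s' cur_reg (reach X n)].
Proof.
move En : (n - p)%N => m; elim: m p s En => [|m IH] p s En le_p good0 best0.
  have Ep : p = n by apply/eqP; rewrite eqn_leq le_p -subn_eq0 En.
  exists 1%N, s; subst p; split=> //; rewrite ?muln0 //.
  by apply: exec_while_false; case: good0 => -[i0 i1 _ _] _ _ _; rewrite /= i0 i1 ltnn.
have lt_p : (p < n)%N by rewrite -subn_gt0 En.
have [good1 best1] := body_spec good0 best0.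
have [|t [s' [ex le_t good' best']]] := IH p.+1 _ _ lt_p good1 best1.
  by rewrite subnS En.
have [tb le_b ex_b] := exec_loop_free s loop_free_body.
exists (tb + t).+1, s'; split=> //.
  by apply: exec_while_true ex_b ex; case: good0 => -[i0 i1 _ _] _ _ _; rewrite /= i0 i1.
rewrite mulnS -addnA -addSn leq_add // ltnS //.
Qed.

Lemma reachP X p q0 q r :
  reach X p q0 q r <->
  exists w : nat -> Q, [/\ w 0%N = q0, w p = q,
    forall i, (i < p)%N -> tr (w i) (w i.+1)
    & r = \sum_(i < p) step_cost X i (w i) (w i.+1)].
Proof.
elim: p q r => [|p IH] q r /=.
  split=> [[<- ->]|[w [<- <- _ ->]]]; last by rewrite big_ord0.
  by exists (fun=> q0); split=> //; rewrite big_ord0.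
split.
  case=> q1 [r1 [/IH[w [w0 wp wtr ->]] tr1 ->]].
  exists (fun i => if (i <= p)%N then w i else q); split=> //.
  - by rewrite ltnn.
  - move=> i; rewrite ltnS leq_eqVlt => /orP[/eqP->|lt_i].
      by rewrite eqxx ltnn wp.
    by rewrite lt_i orbT wtr.
  rewrite big_ord_recr /= leqnn ltnn wp; congr (_ + _).
  by apply: eq_bigr => i _; rewrite ltn_ord (ltnW (ltn_ord i)).
case=> w [w0 wp wtr ->].
exists (w p), (\sum_(i < p) step_cost X i (w i) (w i.+1)).
split; last by rewrite big_ord_recr /= wp.
  by apply/IH; exists w; split=> // i lt_i; apply: wtr; apply: ltnW.
by rewrite -wp wtr.
Qed.

(* The step p of a walk scans x_p; a dynamic program over the pairs (start,
   current state) uses a number of registers that does not depend on n. *)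
Theorem walk_decidable n0 :
  decidable_in_poly_time (R := R) n0 (fun n x =>
    exists w : nat -> Q, [/\ acc (w 0%N) (w n),
      forall i, (i < n)%N -> tr (w i) (w i.+1)
      & \sum_(i < n) (x 0 i *+ a (w i) (w i.+1) - (c (w i) (w i.+1))%:R) < 0]).
Proof.
exists walk_cmd.
(* Each of the n iterations costs the body and one test; the isolated 1 is the test that ends the
   loop. *)
exists ((cmd_size body_cmd).+1%:P * 'X +
  (cmd_size start_cmd + (1 + cmd_size final_cmd))%N%:P).
move=> n x _.
have [good0 best0] := start_spec x.
have [t0 le0 ex0] := exec_loop_free (init x) loop_free_start.
have [t1 [s1 [ex1 le1 good1 best1]]] := while_spec (leq0n n) good0 best0.
have [t2 le2 ex2] := exec_loop_free s1 loop_free_final.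
exists (t0 + (t1 + t2))%N, (sem final_cmd s1); split.
- exact: exec_seq ex0 (exec_seq ex1 ex2).
- apply: (@leq_trans ((cmd_size body_cmd).+1 * n +
    (cmd_size start_cmd + (1 + cmd_size final_cmd)))%N); last by rewrite !hornerE.
  rewrite subn0 in le1; rewrite [X in (_ <= X)%N]addnCA leq_add //.
  by rewrite addnA leq_add.
- rewrite (final_spec good1 best1).
  have sumE (w : nat -> Q) : \sum_(i < n) step_cost (rmem (init x)) i (w i) (w i.+1) =
    \sum_(i < n) (x 0 i *+ a (w i) (w i.+1) - (c (w i) (w i.+1))%:R).
    by apply: eq_bigr => i _; rewrite /step_cost /= valK.
  split.
    case=> q0 [q [r [acc_q /reachP[w [w0 wq wtr rE]] lt_r]]].
    by exists w; rewrite w0 wq -sumE -rE.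
  case=> w [acc_w wtr lt_w]; exists (w 0%N), (w n),
    (\sum_(i < n) step_cost (rmem (init x)) i (w i) (w i.+1)).
  by rewrite sumE; split=> //; apply/reachP; exists w; rewrite sumE.
Qed.

End Walk.

(** * Periodic sets winding once around the circle *)

Section Periodic.

Definition cnt (B : pred nat) (p : nat) : nat := \sum_(i < p) B i.

Definition periodic (n : nat) (B : pred nat) : Prop := forall p, B (p + n) = B p.

(** Consecutive elements are at distance k or k+1, like successive vertices of a cycle winding
    once. *)
Definition spread (k : nat) (B : pred nat) : Prop :=
  forall p, cnt B (p + k) <= (cnt B p).+1 <= cnt B (p + k.+1).

Definition long (k : nat) (B : pred nat) : pred nat := fun p => B p && B (p + k.+1).

Implicit Types (B G : pred nat) (n k p : nat).

Lemma cnt0 B : cnt B 0 = 0.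
Proof. exact: big_ord0. Qed.

Lemma cntS B p : cnt B p.+1 = cnt B p + B p.
Proof. exact: big_ord_recr. Qed.

Lemma eq_cnt B B' : B =1 B' -> cnt B =1 cnt B'.
Proof. by move=> e p; apply: eq_bigr => i _; rewrite e. Qed.

Lemma leq_cnt B p q : p <= q -> cnt B p <= cnt B q.
Proof.
by move=> /subnK <-; elim: (q - p) => // m IH; rewrite addSn cntS; lia.
Qed.

Lemma cnt_lt B p q : p < q -> B p -> cnt B p < cnt B q.
Proof. by move=> lt_pq Bp; apply: leq_trans (leq_cnt B lt_pq); rewrite cntS Bp addn1. Qed.

Lemma cnt_ltP B p q : cnt B p < cnt B q -> exists r, [/\ p <= r, r < q & B r].
Proof.
elim: q => [|q IH]; first by rewrite cnt0.
rewrite cntS; case Bq: (B q) => /= lt_c; last first.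
  have [|r [h1 h2 h3]] := IH; first by rewrite addn0 in lt_c.
  by exists r; split=> //; apply: ltnW.
exists q; split=> //; rewrite leqNgt; apply/negP => lt_q.
by have := leq_cnt B lt_q; rewrite cntS Bq /=; lia.
Qed.

Lemma cnt_period n B p : periodic n B -> cnt B (p + n) = cnt B p + cnt B n.
Proof.
move=> perB; elim: p => [|p IH]; first by rewrite cnt0.
by rewrite addSn !cntS IH perB; lia.
Qed.

Lemma periodicM n B m p : periodic n B -> B (p + m * n) = B p.
Proof.
move=> perB; elim: m => [|m <-]; first by rewrite mul0n addn0.
by rewrite mulSn addnCA addnC perB.
Qed.

Lemma periodic_mod n B p : periodic n B -> B (p %% n) = B p.
Proof. by move=> perB; rewrite [in RHS](divn_eq p n) addnC periodicM. Qed.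

Lemma cnt_shift n B c : periodic n B -> cnt (fun p => B (p + c)) n = cnt B n.
Proof.
move=> perB; have H m : cnt (fun p => B (p + c)) m + cnt B c = cnt B (c + m).
  elim: m => [|m IH]; first by rewrite cnt0 addn0.
  by rewrite addnS !cntS addnAC IH (addnC c).
by apply/eqP; rewrite -(eqn_add2r (cnt B c)) H cnt_period // addnC.
Qed.

(** Lengthening all windows by one position adds each element of a period once; this serves to
    average window counts over the circle. *)
Lemma sum_cnt n B c : periodic n B ->
  \sum_(p < n) cnt B (p + c) = \sum_(p < n) cnt B p + c * cnt B n.
Proof.
move=> perB; elim: c => [|c IH].
  by rewrite addn0; apply: eq_bigr => p _; rewrite addn0.
under eq_bigr => p _ do rewrite addnS cntS.
have -> : \sum_(p < n) (cnt B (p + c) + B (p + c)) =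
    \sum_(p < n) cnt B (p + c) + cnt (fun p => B (p + c)) n by exact: big_split.
by rewrite IH cnt_shift // mulSn; lia.
Qed.

Lemma spread_no_pair k B p q : spread k B -> p < q -> q < p + k -> B p -> B q -> False.
Proof.
move=> spB lt_pq lt_q Bp Bq; have /andP[+ _] := spB p.
have := leq_cnt B lt_q; have := leq_cnt B lt_pq.
by rewrite !cntS Bp Bq /=; lia.
Qed.

(** The window from p + 1 to p + k meets [B] once, unless an arc of length k+1 jumps over it, and
    such an arc starts at p. *)
Lemma long_window k B p : 2 <= k -> spread k B ->
  cnt B (p.+1 + k) + long k B p = (cnt B p.+1).+1.
Proof.
move=> k2 spB; rewrite /long.
have := spB p; have := spB p.+1; have := spB p.+2.
have h1 : cnt B p.+2 <= cnt B (p + k) by apply: leq_cnt; lia.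
move: h1.
rewrite !addSn !addnS !cntS.
case: (B p); case: (B p.+1); case: (B _); case: (B _); case: (B _) => /=; lia.
Qed.

(** Sum [long_window] over a period: n is the total length of the arcs. *)
Lemma spread_count n k B : 2 <= k -> periodic n B -> spread k B ->
  n = k * cnt B n + cnt (long k B) n.
Proof.
move=> k2 perB spB.
have : \sum_(p < n) (cnt B (p + k.+1) + long k B p) = \sum_(p < n) (cnt B (p + 1) + 1).
  by apply: eq_bigr => p _; rewrite addn1 addnS -addSn long_window // addn1.
rewrite !big_split /= !sum_cnt // sum_nat_const card_ord -/(cnt (long k B) n) mulSn; lia.
Qed.

Lemma spread_ex n k B : 0 < n -> periodic n B -> spread k B -> exists2 p, p < n & B p.
Proof.
move=> n_gt0 perB spB; have /andP[_ +] := spB 0; rewrite cnt0 => h.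
have [|r [_ _ Br]] := @cnt_ltP B 0 (0 + k.+1); first by rewrite cnt0.
by exists (r %% n); rewrite ?ltn_pmod // periodic_mod.
Qed.

(* The arcs leaving the vertices B, of length k+1 from those in G and k from the
   others, cover the circle. *)
Lemma arcs_cover n k B G p0 : 0 < n -> periodic n B ->
  (forall p, G p -> B p && B (p + k.+1)) ->
  (forall p, B p -> ~~ G p -> B (p + k)) ->
  periodic n G -> 0 < k -> B p0 ->
  forall p, cnt B p.+1 < cnt B (p.+1 + k) + G p.
Proof.
move=> n_gt0 perB GB nGB perG k_gt0 Bp0.
have base p : B p -> cnt B p.+1 < cnt B (p.+1 + k) + G p.
  move=> Bp; case Gp: (G p); first by rewrite addn1 ltnS leq_cnt // leq_addr.
  rewrite addn0; apply: (@leq_ltn_trans (cnt B (p + k))); first by apply: leq_cnt; lia.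
  by apply: cnt_lt; [lia | apply: nGB; rewrite ?Gp].
have next p : cnt B p.+1 < cnt B (p.+1 + k) + G p ->
              cnt B p.+2 < cnt B (p.+2 + k) + G p.+1.
  move=> h; case Bp1: (B p.+1); first exact: base.
  rewrite cntS Bp1 addn0; case Gp: (G p) h => /=.
    move/GB: Gp => /andP[_ Bk] _; apply: leq_trans (leq_addr _ _).
    by apply: leq_ltn_trans (cnt_lt _ Bk); [apply: leq_cnt|]; lia.
  rewrite addn0 => h; apply: leq_trans (leq_addr _ _); apply: leq_trans h _.
  by apply: leq_cnt; lia.
have later m : cnt B (p0 + m).+1 < cnt B ((p0 + m).+1 + k) + G (p0 + m).
  by elim: m => [|m IH]; rewrite ?addn0 ?addnS; [apply: base | apply: next].
(* The property only propagates forwards from [p0]; adding [p0] periods brings every p beyond it. *)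
move=> p; have := later (p + p0 * n - p0).
rewrite subnKC; last by nia.
have -> : G (p + p0 * n) = G p by apply: periodicM.
have cM q : cnt B (q + p0 * n) = cnt B q + p0 * cnt B n.
  elim: (p0) => [|m IH]; first by rewrite !mul0n !addn0.
  by rewrite !mulSn addnCA addnC cnt_period // IH; lia.
by rewrite -addSn addnAC !cM; lia.
Qed.

(* The arcs cover the circle and have total length n, so they do not overlap. *)
Lemma cover_spread n k B G : 2 <= k -> 0 < n -> periodic n B -> periodic n G ->
  (forall p, G p -> B p) ->
  (forall p, cnt B p.+1 < cnt B (p.+1 + k) + G p) ->
  n = k * cnt B n + cnt G n -> spread k B.
Proof.
move=> k2 n_gt0 perB perG GB cov En.
(* [f] is the excess of coverage, nonnegative by [cov]; its total over a period is 0 by [En]. *)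
pose f p := cnt B (p.+1 + k) + G p - (cnt B p.+1).+1.
have fE p : cnt B (p.+1 + k) + G p = f p + (cnt B p.+1).+1.
  by rewrite /f subnK.
have f0 p : p < n -> f p = 0.
  move=> lt_p; have : \sum_(p < n) f p = 0.
    have : \sum_(p < n) (cnt B (p + k.+1) + G p) = \sum_(p < n) (f p + (cnt B (p + 1) + 1)).
      by apply: eq_bigr => q _; rewrite !addn1 addnS -addSn fE.
    by rewrite !big_split /= !sum_cnt // sum_nat_const card_ord -/(cnt G n); lia.
  move/eqP; rewrite sum_nat_eq0 => /forallP/(_ (Ordinal lt_p)) /=.
  by move=> /eqP.
have fper p : f (p + n) = f p.
  by rewrite /f perG -addSn addnAC !(cnt_period _ perB); lia.
have f00 p : f p = 0.
  have perf : periodic n (fun p => f p == 0) by move=> q; rewrite fper.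
  by apply/eqP; rewrite -(periodic_mod p perf) f0 ?ltn_pmod.
move=> p; apply/andP; split.
  (* [fE] speaks of the window after its argument, so the window at p needs p - 1, here p + n -
     1. *)
  have := fE (p + n.-1); rewrite f00 -!addnS prednK //.
  by rewrite -addnA (addnC n) addnA !(cnt_period _ perB); lia.
have := fE p; rewrite f00 addSnnS => h.
case Gp: (G p) h; rewrite cntS; last by lia.
rewrite (GB _ Gp) => _; have := leq_cnt B (leq_addr k p.+1).
by rewrite cntS (GB _ Gp) addSnnS; lia.
Qed.

End Periodic.

(** * Cycles of the digraph G(C_n^k) *)

Section Lift.
Variable n : nat.
Implicit Types (N : {set 'I_n}) (B : pred nat).

Definition per N : pred nat := fun p => [exists i in N, val i == p %% n].

Lemma per_ord N p (i : 'I_n) : i = p %% n :> nat -> per N p = (i \in N).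
Proof.
move=> Ei; apply/existsP/idP => [[j /andP[jN /eqP Ej]]|iN]; last first.
  by exists i; rewrite iN /= Ei eqxx.
by rewrite (_ : i = j) //; apply: val_inj; rewrite /= Ei.
Qed.

Lemma per_val N (i : 'I_n) : per N i = (i \in N).
Proof. by apply: per_ord; rewrite modn_small. Qed.

Lemma per_periodic N : periodic n (per N).
Proof. by move=> p; rewrite /per modnDr. Qed.

Lemma cnt_set B : cnt B n = #|[set i : 'I_n | B i]|.
Proof.
by rewrite /cnt -sum1_card [RHS]big_mkcond; apply: eq_bigr => i _; rewrite inE; case: (B i).
Qed.

Lemma cnt_per N : cnt (per N) n = #|N|.
Proof. by rewrite cnt_set; congr #|pred_of_set _|; apply/setP => i; rewrite inE per_val. Qed.

Lemma per_set B : periodic n B -> 0 < n -> per [set i : 'I_n | B i] =1 B.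
Proof.
move=> perB n_gt0 p.
by rewrite (@per_ord _ _ (Ordinal (ltn_pmod p n_gt0))) // inE /= periodic_mod.
Qed.

End Lift.

Section Cycles.
Variables n k : nat.
Hypotheses (k2 : 2 <= k) (n_big : k.+2 <= n).
Implicit Types (N : {set 'I_n}).

Let n_gt0 : 0 < n. Proof. by lia. Qed.

Lemma per_arc N (i j : 'I_n) a p : i = p %% n :> nat -> arc a i j ->
  per N (p + a) = (j \in N).
Proof. by move=> Ei /eqP Ej; apply: per_ord; rewrite /= -Ej Ei modnDml. Qed.

(** [long_ends] collects the heads of the arcs of length k+1 while [long] marks their tails, whence
    the shift. *)
Lemma per_long_ends N p : per (long_ends k N) (p + k.+1) = long k (per N) p.
Proof.
pose i := Ordinal (ltn_pmod p n_gt0).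
pose j := Ordinal (ltn_pmod (p + k.+1) n_gt0).
rewrite /long !(@per_ord _ _ (p + k.+1) j) // (@per_ord _ _ p i) // inE andbC.
case: (j \in N); rewrite ?andbF //= ?andbT.
have arc_ij : arc k.+1 i j by rewrite /arc /= modnDml.
apply/existsP/idP => [[l /andP[lN arc_l]]|iN]; last by exists i; rewrite iN arc_ij.
rewrite (_ : i = l) //; apply: val_inj => /=.
have : p + k.+1 = l + k.+1 %[mod n] by rewrite (eqP arc_l).
by move/eqP; rewrite eqn_modDr (modn_small (ltn_ord l)) => /eqP.
Qed.

Lemma card_long_ends N : #|long_ends k N| = cnt (long k (per N)) n.
Proof.
rewrite -cnt_per -(cnt_shift k.+1 (@per_periodic _ _)).
by apply: eq_cnt => p; rewrite per_long_ends.
Qed.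

Lemma arcs_excl (i j : 'I_n) : arc k i j -> arc k.+1 i j = false.
Proof.
move=> /eqP Ej; apply/negP => /eqP Ej'.
have : i + k.+1 = i + k %[mod n] by rewrite Ej' Ej.
move/eqP; rewrite eqn_modDl modn_small ?modn_small; lia.
Qed.

Section OfCycle.
Variable c : seq 'I_n.
Hypothesis cyc : ucycle (arcG k) c.
Let N := [set i in c].
Let G := [set i in c | arc k.+1 i (next c i)].

Lemma dicycle_cover : c != [::] ->
  forall p, cnt (per N) p.+1 < cnt (per N) (p.+1 + k) + per G p.
Proof.
move=> c_ne; have [i ic] : exists i, i \in c
  by case: (c) c_ne => // i s _; exists i; exact: mem_head.
case/andP: (cyc) => cyc_c _.
have next_in (l : 'I_n) : l \in c -> next c l \in N by move=> lc; rewrite inE mem_next.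
apply: (@arcs_cover n k _ _ (val i)) => //; try exact: per_periodic; try by lia.
- move=> p; set l := Ordinal (ltn_pmod p n_gt0).
  rewrite !(@per_ord _ _ p l) // !inE => /andP[lc arc_l].
  by rewrite lc (per_arc _ _ arc_l) //= next_in.
- move=> p; set l := Ordinal (ltn_pmod p n_gt0).
  rewrite !(@per_ord _ _ p l) // !inE => lc; rewrite lc /= => not_arc.
  have := next_cycle cyc_c lc; rewrite /arcG (negbTE not_arc) orbF => arc_l.
  by rewrite (per_arc _ _ arc_l) // next_in.
- by rewrite per_val inE.
Qed.

Lemma card_cycle : #|N| = size c.
Proof. by rewrite cardsE; apply/card_uniqP; case/andP: cyc. Qed.

Lemma card_long_arcs : #|G| = count (fun i => arc k.+1 i (next c i)) c.
Proof.
case/andP: cyc => _ uc; rewrite -size_filter.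
rewrite -(card_uniqP (filter_uniq _ uc)) cardsE.
by apply: eq_card => i; rewrite mem_filter andbC.
Qed.

Lemma count_arcs : count (fun i => arc k i (next c i)) c +
  count (fun i => arc k.+1 i (next c i)) c = size c.
Proof.
case/andP: cyc => cyc_c _; rewrite -(count_predC (fun i => arc k i (next c i)) c).
congr (_ + _); apply: eq_in_count => i ic /=.
have := next_cycle cyc_c ic; rewrite /arcG.
by case E: (arc k i _) => /=; [rewrite arcs_excl | move=> ->].
Qed.

End OfCycle.

(** The arcs of the cycle have total length n, so [cover_spread] applies; comparing the length count
    of [spread_count] with n gives the number of long ends. *)
Lemma dicycle_spread n2 n3 (c : seq 'I_n) : dicycle k n2 n3 c -> n = k * n2 + k.+1 * n3 ->
  [/\ spread k (per [set i in c]), #|[set i in c]| = n2 + n3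
    & #|long_ends k [set i in c]| = n3].
Proof.
case/and4P=> c_ne cyc /eqP En2 /eqP En3 En.
have cN := card_cycle cyc; have cG := card_long_arcs cyc.
have cc := count_arcs cyc; rewrite En2 En3 in cc cG.
have spN : spread k (per [set i in c]).
  apply: (cover_spread k2 n_gt0 (@per_periodic _ _) (@per_periodic _ _) _ (dicycle_cover cyc c_ne)).
    move=> p; rewrite !(@per_ord _ _ p (Ordinal (ltn_pmod p n_gt0))) // !inE.
    by case/andP.
  by rewrite !cnt_per cN cG -cc; lia.
split=> //; first by rewrite cN cc.
have := spread_count k2 (@per_periodic n _) spN.
by rewrite cnt_per -card_long_ends cN -cc; lia.
Qed.

(** Mapping each vertex to its successor gives a permutation whose orbits inside [N] are cycles. One
    orbit is all of [N]: its arcs already cover the circle and leave no room for another vertex. *)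
Lemma spread_dicycle N : spread k (per N) ->
  exists2 c, dicycle k (#|N| - #|long_ends k N|) #|long_ends k N| c & N = [set i in c].
Proof.
move=> spN; have perN := @per_periodic n N.
have [p0 lt_p0 Np0] := spread_ex n_gt0 perN spN.
pose y0 := Ordinal lt_p0.
have y0N : y0 \in N by rewrite -per_val.
pose sh a (i : 'I_n) := Ordinal (ltn_pmod (i + a) n_gt0).
have arc_sh a i : arc a i (sh a i) by rewrite /arc.
have per_sh a (i : 'I_n) : per N (i + a) = (sh a i \in N) by apply: per_ord.
(* Fixing the points outside [N] makes [f] injective on all of Z_n, as [orbit] requires. *)
pose f i := if i \in N then (if sh k i \in N then sh k i else sh k.+1 i) else i.
have succ_ex i : i \in N -> sh k i \notin N -> sh k.+1 i \in N.
  rewrite -!per_sh -per_val => Ni /negbTE nk.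
  have := spN i; have := spN i.+1.
  by rewrite !addSn !addnS !cntS Ni nk; case: (per N _); lia.
have fN i : (f i \in N) = (i \in N).
  rewrite /f; case: ifP => // iN; case: ifP => // /negbT h; exact: succ_ex.
have per_f (i : 'I_n) : i \in N -> per N (i + k) = (f i == sh k i).
  move=> iN; rewrite per_sh /f iN; case: ifP => _; rewrite ?eqxx //.
  by apply/esym/negbTE/eqP => e; have := arcs_excl (arc_sh k i); rewrite -e arc_sh.
have f_inj : injective f.
  have sh_inj a : injective (sh a).
    move=> i j /(congr1 val)/= /eqP; rewrite eqn_modDr !modn_small // => /eqP.
    exact: val_inj.
  have sh_ne i j : i \in N -> j \in N -> sh k i = sh k.+1 j -> False.
    move=> iN jN /(congr1 val)/=; rewrite addnS -addSn => /eqP; rewrite eqn_modDr.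
    rewrite (modn_small (ltn_ord i)) => /eqP Ei.
    apply: (@spread_no_pair k (per N) j j.+1) => //; rewrite ?per_val //; first by lia.
    by rewrite (@per_ord _ _ j.+1 i).
  move=> i j fij; have := fN i; rewrite fij fN => Eij.
  move: fij; rewrite /f -Eij; case: ifP => // jN.
  by case: ifP; case: ifP => // _ _;
    [apply: sh_inj | move/sh_ne => [] | move/esym/sh_ne => [] | apply: sh_inj];
    rewrite -?Eij.
pose c := orbit f y0.
have cyc_f : fcycle f c := cycle_orbit f_inj y0.
have cN i : i \in c -> i \in N.
  rewrite -fconnect_orbit => /iter_findex <-; elim: (findex _ _ _) => //= m.
  by rewrite fN.
have next_f i : i \in c -> next c i = f i.
  by move=> ic; have /eqP := next_cycle cyc_f ic.
have arc_f (i : 'I_n) : i \in N -> arc k.+1 i (f i) = ~~ per N (i + k).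
  move=> iN; rewrite per_f //; case: eqP => [->|]; first by rewrite (arcs_excl (arc_sh _ _)).
  by rewrite /f iN; case: ifP => // _ _; rewrite arc_sh.
have cyc : ucycle (arcG k) c.
  rewrite /ucycle orbit_uniq andbT; apply: (@sub_in_cycle _ (mem N) (frel f)) cyc_f.
    move=> i j iN _ /eqP <-; rewrite /arcG /f iN.
    by case: ifP => _; rewrite arc_sh ?orbT.
  by apply/allP => i /cN.
have y0c : y0 \in c by rewrite -fconnect_orbit.
have c_ne : c != [::] by move: y0c; case: (c).
have NE : N = [set i in c].
  apply/setP => i; rewrite inE; apply/idP/idP => [iN|/cN//].
  have sub p : per [set i in c] p -> per N p.
    by rewrite !(@per_ord _ _ p (Ordinal (ltn_pmod p n_gt0))) // inE => /cN.
  have Ni : per N (i + n) by rewrite perN per_val.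
  (* The window of k positions ending at i contains a vertex of the orbit, unless an arc of length
     k+1 jumps over it; that arc would end at i + 1, right after i. A vertex other than i would also
     be too close to i. *)
  have := dicycle_cover cyc c_ne (i + n - k).
  set G := [set j in c | _]; case Gi: (per G (i + n - k)).
    move=> _; case: (@spread_no_pair k (per N) (i + n) (i + n).+1); rewrite ?per_val //; try lia.
    move: Gi; rewrite (@per_ord _ _ _ (Ordinal (ltn_pmod (i + n - k) n_gt0))) // inE.
    case/andP => jc arc_j.
    have -> : (i + n).+1 = i + n - k + k.+1 by lia.
    by rewrite (@per_arc _ _ _ _ _ _ arc_j) // cN // mem_next.
  rewrite addn0 => /cnt_ltP[r [le_r lt_r Br]].
  case: (ltngtP r (i + n)) => [lt|lt|Er].
  - by have [] := spread_no_pair spN lt _ (sub _ Br) Ni; lia.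
  - lia.
  - by move: Br; rewrite Er per_periodic per_val inE.
have card_long : count (fun i => arc k.+1 i (next c i)) c = #|long_ends k N|.
  rewrite -card_long_arcs // card_long_ends cnt_set; apply: eq_card => i; rewrite !inE.
  rewrite /long per_val NE inE; case ic: (i \in c) => //=; rewrite -NE.
  rewrite next_f // arc_f ?cN //; apply/idP/idP; rewrite !per_sh.
    by apply: succ_ex; apply: cN.
  rewrite -!per_sh => h1; apply/negP => h2.
  by apply: (spread_no_pair spN _ _ h2 h1); lia.
have := count_arcs cyc; rewrite -card_cycle // -NE card_long => <-.
by exists c => //; apply/and4P; split; rewrite ?addnK ?card_long.
Qed.

End Cycles.

(** * Disjoint cycles define a circulant minor *)

(** A discrete intermediate value property: [cnt B] grows by steps of one, exactly at the elements
    of [B]. *)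
Lemma cnt_attains (B : pred nat) p q a :
  cnt B p <= a -> a < cnt B q -> exists r, [/\ p <= r, r < q, B r & cnt B r = a].
Proof.
move=> le_p; elim: q => [|q IH]; first by rewrite cnt0.
rewrite cntS; case Bq: (B q) => lt_a; last first.
  have [|r [h1 h2 h3 h4]] := IH; first by rewrite addn0 in lt_a.
  by exists r; split=> //; apply: ltnW.
have [lt_q|ge_q] := ltnP a (cnt B q).
  by have [r [h1 h2 h3 h4]] := IH lt_q; exists r; split=> //; apply: ltnW.
have Eq : cnt B q = a by lia.
exists q; split=> //; rewrite leqNgt; apply/negP => /(leq_cnt B).
by rewrite cntS Bq; lia.
Qed.

Definition arc_mod (n a m b : nat) : Prop := exists2 s, s < m & (a + s) %% n = b.

Lemma arc_mod_modl n a m b : arc_mod n (a %% n) m b <-> arc_mod n a m b.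
Proof. by split=> -[s lt_s <-]; exists s; rewrite ?modnDml. Qed.

(** A cyclic interval of at least K residues inside one of K < n residues equals it: if it started
    later or were longer, it would contain a' + K, the first residue past the end. *)
Lemma arc_mod_sub n a a' m K : 0 < K < n -> K <= m ->
  (forall b, arc_mod n a m b -> arc_mod n a' K b) -> m = K /\ a = a' %[mod n].
Proof.
case/andP=> K_gt0 lt_K le_m sub.
have not_end x : x = a' + K %[mod n] -> ~ arc_mod n a' K (x %% n).
  move=> -> [s lt_s /eqP]; rewrite eqn_modDl !modn_small; lia.
have [s lt_s Es] : arc_mod n a' K (a %% n).
  by apply: sub; exists 0; rewrite ?addn0 //; lia.
have s0 : s = 0.
  case: s lt_s Es => // s lt_s Es; case: (not_end (a + (K - s.+1))).
    by rewrite -modnDml -Es modnDml; congr (_ %% _); lia.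
  by apply: sub; exists (K - s.+1) => //; lia.
rewrite s0 addn0 in Es; split=> //.
have [lt_m|] := ltnP K m; last by lia.
case: (not_end (a + K)); first by rewrite -modnDml -Es modnDml.
by apply: sub; exists K.
Qed.

Section Minor.
Variables (n k n' K : nat) (N : {set 'I_n}).
(** [V] marks the columns that stay, and [v p] counts those before p, which is the new index of p
    when p stays. *)
Let V : pred nat := fun p => ~~ per N p.
Let v := cnt V.
Hypotheses (n_gt0 : 0 < n) (vn : v n = n') (K_small : 0 < K < n').
Hypothesis window_size : forall p, v p + K <= v (p + k) <= v p + K.+1.
Hypothesis window_long : forall p, v (p.+1 + k) = v p.+1 + K.+1 -> ~~ V p.

Let perV : periodic n V. Proof. by move=> p; rewrite /V per_periodic. Qed.

Let v_mod p : v (p %% n) = v p %[mod n'].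
Proof.
rewrite [in RHS](divn_eq p n); elim: (p %/ n) => [|m IH]; first by rewrite mul0n.
by rewrite mulSn -addnA addnC /v cnt_period // -/v vn modnDr.
Qed.

Let V_ord (c : 'I_n) : V c = (c \notin N).
Proof. by rewrite /V per_val. Qed.

Let v_inj p q : V p -> V q -> v p = v q -> p = q.
Proof.
by move=> Vp Vq e; case: (ltngtP p q) => // lt;
  [have := cnt_lt lt Vp | have := cnt_lt lt Vq]; rewrite -/v e ltnn.
Qed.

Let v_lt (c : 'I_n) : c \notin N -> v c < n'.
Proof. by rewrite -V_ord -vn; apply: cnt_lt. Qed.

Let in_row (j c : 'I_n) : bool := [exists t : 'I_k, (j + t) %% n == c].
Let len (j : nat) := v (j + k) - v j.

Let in_rowP (j c : 'I_n) : c \notin N ->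
  reflect (arc_mod n' (v j) (len j) (v c)) (in_row j c).
Proof.
move=> cN; have Vc : V c by rewrite V_ord.
apply: (iffP existsP) => [[t /eqP Et]|[s lt_s Es]].
  have Vp : V (j + t) by rewrite -(periodic_mod _ perV) Et.
  have le_v : v j <= v (j + t) by apply: leq_cnt; lia.
  have lt_v : v (j + t) < v (j + k) by apply: cnt_lt => //; rewrite ltn_add2l.
  exists (v (j + t) - v j); first by rewrite /len; lia.
  by rewrite subnKC // -v_mod Et modn_small ?v_lt.
have [||p [le_p lt_p Vp vp]] := @cnt_attains V j (j + k) (v j + s).
- by rewrite leq_addr.
- by move: lt_s; rewrite /len -/v; lia.
have lt_t : p - j < k by lia.
exists (Ordinal lt_t); rewrite /= subnKC //; apply/eqP/v_inj => //.
  by rewrite periodic_mod.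
have lt_pm := ltn_pmod p n_gt0.
rewrite -/v in vp; have := v_mod p; rewrite vp Es modn_small //.
by rewrite (v_lt (c := Ordinal lt_pm)) // -V_ord /= periodic_mod.
Qed.

Let circE (j c : 'I_n) : circ n k j c = in_row j c.
Proof. by rewrite mxE. Qed.

Let has_col a : a < n' -> exists2 c : 'I_n, c \notin N & v c = a.
Proof.
move=> lt_a; have [||p [_ lt_p Vp vp]] := @cnt_attains V 0 n a.
- by rewrite cnt0.
- by rewrite -/v vn.
by exists (Ordinal lt_p); rewrite -?V_ord.
Qed.

Let domP (j l : 'I_n) :
  reflect (forall b, arc_mod n' (v l) (len l) b -> arc_mod n' (v j) (len j) b)
          (row_dominates k N j l).
Proof.
apply: (iffP forall_inP) => [h b b_l|h c cN].
  have lt_b : b < n' by case: b_l => s _ <-; rewrite ltn_pmod; lia.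
  have [c cN Ec] := has_col lt_b; rewrite -Ec in b_l *.
  by apply/in_rowP => //; move/(in_rowP _ cN): b_l (h c cN); rewrite !circE => ->; case: in_row.
rewrite !circE; case E: (in_row l c) => //=.
by rewrite lt0b; apply/in_rowP => //; apply/h/in_rowP.
Qed.

Let short j := len j == K.

Let len_bounds j : K <= len j <= K.+1.
Proof. by have := window_size j; rewrite /len; lia. Qed.

Let dom_start (j l : 'I_n) :
  short l -> v l = v j %[mod n'] -> row_dominates k N j l.
Proof.
move=> /eqP sh e; apply/domP => b; rewrite sh -arc_mod_modl e arc_mod_modl.
case=> s lt_s Es; exists s => //.
by apply: leq_trans lt_s _; case/andP: (len_bounds j).
Qed.

Let dom_short (j l : 'I_n) : short j -> row_dominates k N j l ->
  short l /\ v l = v j %[mod n'].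
Proof.
move=> /eqP sh /domP; rewrite sh => /(arc_mod_sub K_small)[]; last by move=> /eqP.
by case/andP: (len_bounds l).
Qed.

(** Among the positions with a given value of [v], the first starts a short row: a row keeping K+1
    columns comes right after a deleted column, hence after a position with the same [v]. *)
Let has_short a : a < n' -> exists2 l : 'I_n, short l & v l %% n' = a.
Proof.
move=> lt_a; have [c _ vc] := has_col lt_a.
(* Adding n' makes the value positive, so the least such p has a predecessor. *)
have ex : exists p, v p == a + n'.
  by exists (c + n); rewrite /v cnt_period // -/v vn vc.
case: (ex_minnP ex) => p /eqP vp p_min.
have sh : short p.
  have := len_bounds p; rewrite /short; case: eqP => // ne /andP[ge_K le_K].
  case: p vp p_min ne ge_K le_K => [|p] vp p_min ne ge_K le_K.
    by move: vp; rewrite /v cnt0; lia.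
  have /negbTE Vp : ~~ V p.
    by apply: window_long; move: ne ge_K le_K (window_size p.+1); rewrite /len; lia.
  have e : v p.+1 = v p by rewrite /v cntS Vp addn0.
  by have := p_min p; rewrite -e vp eqxx ltnn => /(_ isT).
have lt_pm := ltn_pmod p n_gt0.
exists (Ordinal lt_pm); last by rewrite /= v_mod vp modnDr modn_small.
move: sh; rewrite /short /len => /eqP shE; apply/eqP; rewrite -{}shE /=.
have vM q m : v (q + m * n) = v q + m * n'.
  elim: m => [|m IH]; first by rewrite mul0n !addn0.
  by rewrite !mulSn addnCA addnC /v cnt_period // -/v IH vn; lia.
have h q : v (p + q) = v (p %% n + q) + p %/ n * n'.
  by rewrite -vM; congr v; rewrite {1}(divn_eq p n); lia.
by have := h k; have := h 0; rewrite !addn0; lia.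
Qed.

Let row_of a (l : 'I_n) : Prop :=
  [/\ short l, v l %% n' = a
    & forall l' : 'I_n, short l' -> v l' %% n' = a -> l <= l'].

Let has_row (a : 'I_n') : exists l, row_of a l.
Proof.
have [l0 sh0 v0] := has_short (ltn_ord a).
pose P (l : 'I_n) := short l && (v l %% n' == a).
have P0 : P l0 by rewrite /P sh0 v0 /=.
case: (@arg_minnP _ l0 P (fun l => val l) P0) => l /andP[sh /eqP vl] l_min.
by exists l; split=> // l' sh' /eqP v'; apply: l_min; rewrite /P sh'.
Qed.

Let row_of_inj a l l' : row_of a l -> row_of a l' -> l = l'.
Proof.
case=> s1 v1 m1 [s2 v2 m2]; apply: val_inj.
by apply/eqP; rewrite eqn_leq m1 // m2.
Qed.

(** Every row dominates the short rows with its start, and a short row dominates nothing but these.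
    So what survives is, for each start, the short row of least index. *)
Let kept_row (l : 'I_n) : (l \notin deleted_rows k N) <-> row_of (v l %% n') l.
Proof.
rewrite inE; split.
  move=> kept; have lt_a : v l %% n' < n' by rewrite ltn_pmod; lia.
  have [l0 row0] := has_row (Ordinal lt_a).
  suff -> : l = l0 by case: row0 => s0 v0 m0; split=> // l' s' v'; apply: m0; rewrite // v' v0.
  have [s0 v0 m0] := row0.
  apply/eqP; apply: contraNT kept => ne; apply/existsP; exists l0.
  rewrite eq_sym ne (dom_start s0 v0) /=; apply/implyP => dom.
  have [s1 _] := dom_short s0 dom.
  by rewrite ltn_neqAle (inj_eq val_inj) eq_sym ne m0.
case=> sh _ l_min; apply/existsP => -[l' /and3P[ne dom /implyP lt]].
have [sh' v'] := dom_short sh dom.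
have : l' < l by apply/lt/dom_start.
by rewrite ltnNge l_min.
Qed.

(* Row j of C_n^k / N is the arc of Z_n' from v j to v (j + k), of length K or K+1;
   the rows that are kept are the arcs of length K, once each. *)
Lemma minor_iso_window : minor_iso k N n' K.
Proof.
have [f fP] := fin_all_exists has_row.
have col_ex (a : 'I_n') : exists c : 'I_n, c \notin N /\ v c = a.
  by have [c cN vc] := has_col (ltn_ord a); exists c.
have [g gP] := fin_all_exists col_ex.
exists f, g; split.
- move=> a b e; apply: val_inj => /=.
  by case: (fP a) (fP b) => _ <- _ [_ <- _]; rewrite e.
- move=> a b e; apply: val_inj => /=.
  by case: (gP a) (gP b) => _ <- [_ <-]; rewrite e.
- apply/setP => l; rewrite in_setC; apply/imsetP/idP => [[a _ ->]|/kept_row row_l].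
    by apply/kept_row; case: (fP a) => s va m; rewrite va.
  have lt_a : v l %% n' < n' by rewrite ltn_pmod; lia.
  by exists (Ordinal lt_a) => //; exact: row_of_inj row_l (fP (Ordinal lt_a)).
- apply/setP => c; rewrite in_setC; apply/imsetP/idP => [[a _ ->]|cN].
    by case: (gP a).
  exists (Ordinal (v_lt cN)) => //; have [gN vg] := gP (Ordinal (v_lt cN)).
  by apply/val_inj/v_inj; rewrite ?V_ord.
apply/matrixP => a b; rewrite [LHS]mxE circE [RHS]mxE; congr nat_of_bool.
have [gN vg] := gP b; have [/eqP sh vf _] := fP a.
apply/in_rowP/existsP => //; rewrite sh vg -arc_mod_modl vf.
  by case=> s lt_s Es; exists (Ordinal lt_s); rewrite /= Es.
by case=> t /eqP Et; exists t.
Qed.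

End Minor.

(** The window after p loses one column per cycle, except that it keeps one more when a long arc
    starts at p. By disjointness at most one does, and p is then a deleted column, as
    [minor_iso_window] demands. *)
Lemma minor_iso_spread n k d (Nf : 'I_d -> {set 'I_n}) :
  2 <= k -> k.+2 <= n ->
  (forall j, spread k (per (Nf j))) ->
  (forall j1 j2, j1 != j2 -> [disjoint Nf j1 & Nf j2]) ->
  let n' := n - #|\bigcup_(j < d) Nf j| in
  0 < k - d < n' -> minor_iso k (\bigcup_(j < d) Nf j) n' (k - d).
Proof.
move=> k2 n_big spN disN n' Ksmall; have n_gt0 : 0 < n by lia.
set N := \bigcup_(j < d) Nf j in n' Ksmall *.
have NE p : per N p = \sum_(j < d) per (Nf j) p :> nat.
  pose i := Ordinal (ltn_pmod p n_gt0).
  have pE M : per M p = (i \in M) by apply: per_ord.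
  under eq_bigr => j _ do rewrite pE.
  rewrite pE; case: (boolP (i \in N)) => [/bigcupP[j _ ij]|iN]; last first.
    rewrite big1 // => j _; case: (boolP (i \in Nf j)) => // ij.
    by case/bigcupP: iN; exists j.
  rewrite (bigD1 j) //= ij big1 // => j' ne.
  by rewrite (disjointFl (disN _ _ ne) ij).
have cntN p : cnt (per N) p = \sum_(j < d) cnt (per (Nf j)) p.
  by rewrite exchange_big; apply: eq_bigr => i _; rewrite NE.
pose v := cnt (fun p => ~~ per N p).
have vE p : v p + cnt (per N) p = p.
  elim: p => [|p IH]; first by rewrite /v !cnt0.
  by rewrite /v !cntS -/v; case: (per N p) => /=; lia.
pose lg p := \sum_(j < d) long k (per (Nf j)) p.
have lg_le p : lg p <= per N p.
  by rewrite NE leq_sum // => j _; rewrite /long; case: (per _ p) => //=; apply: leq_b1.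
have win p : v (p.+1 + k) = v p.+1 + (k - d) + lg p.
  have : cnt (per N) (p.+1 + k) + lg p = cnt (per N) p.+1 + d.
    rewrite !cntN -big_split /=.
    transitivity (\sum_(j < d) (cnt (per (Nf j)) p.+1 + 1)).
      by apply: eq_bigr => j _; rewrite long_window // addn1.
    by rewrite big_split /= sum1_card card_ord.
  by have := vE (p.+1 + k); have := vE p.+1; lia.
have vn : v n = n' by have := vE n; rewrite cnt_per /n'; lia.
have pv p : v (p + n) = v p + n'.
  by rewrite -vn; apply: cnt_period => q; rewrite per_periodic.
apply: minor_iso_window => //.
- move=> p; rewrite -/v.
  have := win (p + n.-1); rewrite -addnS prednK // addnAC !pv.
  by have := lg_le (p + n.-1); case: (per N _); lia.
- move=> p; rewrite negbK -/v win => e.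
  by have := lg_le p; case: (per N p) => //; lia.
Qed.

(** * The distance back to the last vertex *)

(** From the first element on, t p + 1 is the distance from p back to the last element before p. An
    arc ending at p has length k or k+1 according as t p is k - 1 or k. *)
Definition clock (B : pred nat) (t : nat -> nat) : Prop :=
  forall p, t p.+1 = if B p then 0 else (t p).+1.

Definition timed (k : nat) (B : pred nat) (t : nat -> nat) : Prop :=
  [/\ clock B t, forall p, t p <= k & forall p, B p -> k.-1 <= t p].

Section Clock.
Variables (B : pred nat) (t : nat -> nat).
Hypothesis tB : clock B t.

Lemma clock_run p s :
  (cnt B (p + s) = cnt B p /\ t (p + s) = t p + s) \/
  (cnt B p < cnt B (p + s) /\ t (p + s) < s).
Proof.
elim: s => [|s IH]; first by left; rewrite !addn0.
by rewrite addnS cntS tB; case: (B (p + s)); lia.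
Qed.

Lemma clock_last q s : t (q + s).+1 = s -> B q.
Proof.
elim: s => [|s IH]; rewrite tB; first by rewrite addn0; case: (B q).
by rewrite addnS; case: (B _) => // -[]; apply: IH.
Qed.

End Clock.

Lemma timed_spread k B t : 2 <= k -> timed k B t -> spread k B.
Proof.
move=> k2 [tB t_le tk] p; apply/andP; split; last first.
  by have := t_le (p + k.+1); case: (clock_run tB p k.+1) => -[]; lia.
suff H s : s <= k -> cnt B (p + s) = cnt B p \/
    cnt B (p + s) = (cnt B p).+1 /\ t (p + s) < s.
  by case: (H k (leqnn k)) => [|[]]; lia.
elim: s => [|s IH] le_s; first by left; rewrite addn0.
have := IH (ltnW le_s); rewrite addnS cntS tB; case Bs: (B _) => /=; last by lia.
by have := tk _ Bs; lia.
Qed.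

Lemma timed_long k B t p : 2 <= k -> timed k B t ->
  B (p + k.+1) && (t (p + k.+1) == k) = long k B p.
Proof.
move=> k2 tm; have := long_window p k2 (timed_spread k2 tm).
have [tB _ _] := tm; have := clock_run tB p.+1 k; rewrite -addSnnS.
have tp := tB p.
case lg: (long k B p) => /= run win; last by case: eqP; rewrite ?andbF ?andbT //; lia.
move: lg tp; rewrite /long -addSnnS => /andP[-> -> /= t0].
by apply/eqP; lia.
Qed.

(** A clock started at an arbitrary value is right after the first vertex. That vertex lies below n,
    so shifting by n discards the transient and leaves a periodic clock. *)
Lemma spread_timed n k B : 2 <= k -> k.+2 <= n -> periodic n B -> spread k B ->
  exists2 t, timed k B t & forall p, t (p + n) = t p.
Proof.
move=> k2 n_big perB spB.
pose tau := fix tau p := if p is p'.+1 then if B p' then 0 else (tau p').+1 else 0.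
have tauB : clock B tau by [].
have tau_le m : n <= m -> tau m <= k.
  move=> le_m; have := spB (m - k.+1); have := clock_run tauB (m - k.+1) k.+1.
  by rewrite subnK; lia.
have [|q lt_q Bq] := @spread_ex n k B _ perB spB; first by lia.
have sync s : tau (q.+1 + s + n) = tau (q.+1 + s).
  elim: s => [|s IH]; first by rewrite addn0 /= perB Bq.
  by rewrite addnS (addSn (q.+1 + s)) (tauB (q.+1 + s + n)) (tauB (q.+1 + s)) perB IH.
exists (fun p => tau (p + n)) => [|p]; last first.
  by have := sync (p + n - q.+1); rewrite subnKC //; lia.
split=> [p|p|p Bp]; first by rewrite addSn tauB perB.
  by apply: tau_le; lia.
have le_t : tau (p + n) <= k by apply: tau_le; lia.
rewrite leqNgt; apply/negP => lt_t.
have Bl : B (p + n - (tau (p + n)).+1).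
  by apply: (clock_last tauB (s := tau (p + n))); congr tau; lia.
apply: (@spread_no_pair k B _ (p + n) spB _ _ Bl); rewrite ?perB //; lia.
Qed.

(** * Alternated minors as families of periodic sets *)

Lemma ceil_div_MDl b q a : 0 < b -> ceil_div (b * q + a) b = q + ceil_div a b.
Proof.
move=> b_gt0; rewrite /ceil_div mulnC divnMDl // dvdn_addr ?dvdn_mull //; lia.
Qed.

(** With n = k (n2 + n3) + n3, both ceilings of the relevance condition contain the summand n2 + n3;
    what remains depends only on d and m = n3. *)
Definition good_count (k d m : nat) : bool :=
  [&& (2 <= d <= k - 2) || ((d == 1) && (m == 1 %[mod k.-1])),
      ~~ (k - d %| m) & ceil_div m k < ceil_div m (k - d)].

Lemma good_count_bounds k d m : 2 <= k -> good_count k d m ->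
  [/\ 0 < d, d < k & 0 < m].
Proof.
move=> k2 /and3P[dk ndvd _]; split; last by case: m ndvd {dk} => //; rewrite dvdn0.
  by case/orP: dk => [|/andP[/eqP->]//]; lia.
by case/orP: dk => [|/andP[/eqP->]//]; lia.
Qed.

Lemma relevant_params n k d n2 n3 : d < k -> n = k * (n2 + n3) + n3 ->
  [/\ n - d * (n2 + n3) = (k - d) * (n2 + n3) + n3,
      minor_rhs n k d 1 n2 n3 = n2 + n3 + ceil_div n3 (k - d)
    & relevant n k d 1 n2 n3 <->
      ~~ (k - d %| n3) && (ceil_div n3 k < ceil_div n3 (k - d))].
Proof.
move=> lt_dk En; have En' : n - d * (n2 + n3) = (k - d) * (n2 + n3) + n3.
  by rewrite En mulnBl; have := leq_mul2r (n2 + n3) d k; lia.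
have Er : minor_rhs n k d 1 n2 n3 = n2 + n3 + ceil_div n3 (k - d).
  by rewrite /minor_rhs En' muln1 ceil_div_MDl //; lia.
split=> //; rewrite /relevant Er muln1 En' dvdn_addr ?dvdn_mulr //.
rewrite {1}En ceil_div_MDl; last by lia.
by rewrite ltn_add2l; split=> [[-> ->]|/andP].
Qed.

(** The expression c %/ d + (j < c %% d) counts the naturals below c congruent to j modulo d. *)
Lemma divn_modS c d j : j < d ->
  c %/ d + (j < c %% d) + (j == c %% d) = c.+1 %/ d + (j < c.+1 %% d).
Proof.
move=> lt_j; have d_gt0 : 0 < d by lia.
have lt_r := ltn_pmod c d_gt0.
have [E|ne] := eqVneq (c %% d).+1 d.
  have -> : c.+1 = (c %/ d).+1 * d by rewrite {1}(divn_eq c d) mulSn; lia.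
  by rewrite mulnK // modnMl ltn0; case: ltngtP; lia.
have -> : c.+1 = c %/ d * d + (c %% d).+1 by rewrite addnS -divn_eq.
have lt_r1 : (c %% d).+1 < d by lia.
rewrite divnMDl // modnMDl (divn_small lt_r1) (modn_small lt_r1) ltnS addn0 -addnA.
by case: (ltngtP j (c %% d)).
Qed.

(** * Ranks of the elements of W *)

Section Rank.
Variable n : nat.
Implicit Types W : {set 'I_n}.

Lemma nth_filter_iota (B : pred nat) p m : p < m -> B p ->
  nth 0 [seq q <- iota 0 m | B q] (cnt B p) = p.
Proof.
move=> lt_p Bp; have -> : m = p + (m - p) by lia.
rewrite iotaD filter_cat nth_cat.
have -> : size [seq q <- iota 0 p | B q] = cnt B p.
  rewrite size_filter -sum1_count big_mkcond /cnt -[p in iota 0 p]subn0 -/(index_iota 0 p).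
  by rewrite big_mkord; apply: eq_bigr => i _; case: (B i).
rewrite ltnn subnn; case E: (m - p) => [|r]; first by lia.
by rewrite /= Bp.
Qed.

Lemma elt_filter W : elt W =1 nth 0 [seq q <- iota 0 n | per W q].
Proof.
move=> s; congr (nth 0 _ s).
rewrite -val_enum_ord filter_map; congr map.
rewrite {1}/enum_mem -enumT; apply: eq_filter => i.
by rewrite /= per_val.
Qed.

Lemma elt_rank W (i : 'I_n) : i \in W -> elt W (cnt (per W) i) = i.
Proof. by move=> iW; rewrite elt_filter nth_filter_iota // per_val. Qed.

Lemma elt_ex W s : s < #|W| -> exists i : 'I_n, [/\ i \in W, elt W s = i & cnt (per W) i = s].
Proof.
rewrite -cnt_per => lt_s; have [|r [_ lt_r Wr Er]] := @cnt_attains (per W) 0 n s _ lt_s.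
  by rewrite cnt0.
exists (Ordinal lt_r); split=> //; first by rewrite -per_val.
by rewrite -Er (elt_rank (i := Ordinal lt_r)) // -per_val.
Qed.

(** Membership in a class becomes a condition on the rank modulo d, which a scan of the positions
    can maintain. *)
Lemma alternate_set W d m j : j < d -> #|W| = d * m ->
  [set i : 'I_n | [exists t : 'I_m, val i == elt W (j + t * d)]] =
  [set i in W | cnt (per W) i %% d == j].
Proof.
move=> lt_j cW; apply/setP => i; rewrite !inE; apply/existsP/andP.
  case=> t /eqP /= Et; have [|i' [iW Ei' rk]] := @elt_ex W (j + t * d).
    by rewrite cW; have := ltn_ord t; nia.
  have -> : i = i' by apply: val_inj; rewrite /= Et.
  by split=> //; rewrite rk addnC modnMDl modn_small.
case=> iW /eqP Ej; have lt_rk : cnt (per W) i < d * m.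
  by rewrite -cW -cnt_per; apply: cnt_lt; rewrite ?per_val.
have lt_t : cnt (per W) i %/ d < m by rewrite ltn_divLR 1?mulnC //; lia.
exists (Ordinal lt_t); apply/eqP; rewrite /= -[LHS](elt_rank iW) addnC.
by rewrite {1}(divn_eq (cnt (per W) i) d) Ej.
Qed.

End Rank.

(* p + n - k.+1 stands for p - (k + 1), which truncated subtraction would spoil. *)
Definition ends (n k : nat) (B : pred nat) : pred nat :=
  fun p => B p && B (p + n - k.+1).

Definition all_ends (n k d : nat) (B : nat -> pred nat) : pred nat :=
  fun p => [exists j : 'I_d, ends n k (B j) p].

(** For d = 1 the two conditions modulo d are void, so both kinds of alternated minors are covered.
    The divisibility makes all W^j equally large, so [B 0] alone determines n3. *)
Definition alternating_family (n k d : nat) (B : nat -> pred nat) : Prop :=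
  let W := all_ends n k d B in
  [/\ forall j : 'I_d, periodic n (B j) /\ spread k (B j),
      forall (j1 j2 : 'I_d) p, B j1 p -> B j2 p -> j1 = j2,
      forall (j : 'I_d) p, p < n -> ends n k (B j) p -> cnt W p %% d = j,
      d %| cnt W n
    & good_count k d (cnt (ends n k (B 0)) n)].

(** * Alternated minors correspond to alternating families *)

Section Family.
Variables (n k : nat).
Hypotheses (k2 : 2 <= k) (n_big : k.+2 <= n).

Lemma per_long_endsE (N : {set 'I_n}) p : per (long_ends k N) p = ends n k (per N) p.
Proof.
rewrite -per_periodic (_ : p + n = p + n - k.+1 + k.+1); last by lia.
rewrite per_long_ends // /long subnK; last by lia.
by rewrite per_periodic andbC.
Qed.

(** The ends of [B j] are the elements of the union whose rank is j modulo d; when d divides the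
    total, every residue occurs equally often. *)
Lemma cnt_ends (B : nat -> pred nat) d (j : 'I_d) :
  (forall (j : 'I_d) p, p < n -> ends n k (B j) p -> cnt (all_ends n k d B) p %% d = j) ->
  d %| cnt (all_ends n k d B) n ->
  cnt (ends n k (B j)) n = cnt (all_ends n k d B) n %/ d.
Proof.
set W := all_ends n k d B => alt dvd.
suff H p : p <= n -> cnt (ends n k (B j)) p = cnt W p %/ d + (j < cnt W p %% d).
  by rewrite H // (eqP dvd) addn0.
elim: p => [|p IH] lt_p; first by rewrite !cnt0 div0n mod0n.
rewrite !cntS IH ?(ltnW lt_p) //; case Wp: (W p) => /=; last first.
  rewrite addn0; case E: (ends _ _ _ _); last by rewrite addn0.
  by case/existsP: Wp; exists j.
rewrite addn1 -divn_modS //; congr (_ + nat_of_bool _).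
have [j0 Ej0] := existsP Wp.
apply/idP/eqP => [/(alt _ _ lt_p)//|Ej].
by have := alt _ _ lt_p Ej0; rewrite -Ej => /val_inj ->.
Qed.

Lemma card_disjoint_bigcup d (Nf : 'I_d -> {set 'I_n}) q :
  (forall j1 j2, j1 != j2 -> [disjoint Nf j1 & Nf j2]) ->
  (forall j, #|Nf j| = q) -> #|\bigcup_(j < d) Nf j| = d * q.
Proof.
move=> dis cq.
have sumE (i : 'I_n) : (i \in \bigcup_(j < d) Nf j) = \sum_(j < d) (i \in Nf j) :> nat.
  case: (boolP (i \in _)) => [/bigcupP[j _ ij]|ni]; last first.
    rewrite big1 // => j _; case: (boolP (i \in Nf j)) => // ij.
    by case/bigcupP: ni; exists j.
  by rewrite (bigD1 j) //= ij big1 // => j' ne; rewrite (disjointFl (dis _ _ ne) ij).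
have cardE (M : {set 'I_n}) : #|M| = \sum_i (i \in M).
  by rewrite -sum1_card big_mkcond; apply: eq_bigr => i _; case: (i \in M).
rewrite cardE; under eq_bigr => i _ do rewrite sumE.
by rewrite exchange_big /=; under eq_bigr => j _ do rewrite -cardE cq;
  rewrite sum_nat_const card_ord.
Qed.

Local Open Scope ring_scope.

Lemma violatedE (R : realType) (x : 'rV[R]_n) (W : {set 'I_n}) r :
  violated x W r = (\sum_i x 0 i *+ (1 + (i \in W)) < r%:R).
Proof.
rewrite /violated [in RHS](bigID (mem W)) /=; congr (_ + _ < _).
  by apply: eq_bigr => i ->; rewrite mulr_natl.
by apply: eq_bigr => i /negbTE ->.
Qed.

(** A minor gives the periodic extensions of its cycles. Conversely, the sets of a family have the
    same number n3 of long ends, and the length count then makes them equally large; this recovers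
    n2 and the cycles, and the isomorphism comes for free. *)
Lemma violates_family (R : realType) (x : 'rV[R]_n) :
  violates_alternated_minor k x <->
  exists d B, alternating_family n k d B /\
    \sum_(i < n) x 0 i *+ (1 + all_ends n k d B i) <
    (cnt (B 0%N) n + ceil_div (cnt (ends n k (B 0%N)) n) (k - d))%:R.
Proof.
split.
  case=> d [n2 [n3 [W [alt viol]]]].
  (* Both kinds of minors are brought to one form; for d = 1 the residue condition selects all of
     [W]. *)
  have [dk [Nf [def rel altW]]] : (d == 1%N) && (n3 == 1 %[mod k.-1]) || (2 <= d <= k - 2)%N /\
    exists Nf : 'I_d -> {set 'I_n},
      [/\ defines_minor k 1 n2 n3 Nf W, relevant n k d 1 n2 n3
     & #|W| = (d * n3)%N /\ forall j : 'I_d,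
         long_ends k (Nf j) = [set i in W | (cnt (per W) i %% d == j)%N]].
    case: alt => [[le_d [Nf [d2 def rel cW alt]]]|[d1 n3k rel [Nf def]]].
      split; first by rewrite d2 le_d orbT.
      exists Nf; split=> //; split=> // j.
      by rewrite alt (alternate_set (ltn_ord j) cW).
    split; first by rewrite d1 eqxx n3k eqxx.
    exists Nf; split=> //; subst d.
    case: def => [[_ _ En] cyc _ _ EW].
    have EW0 : W = long_ends k (Nf ord0) by rewrite EW big_ord_recl big_ord0 setU0.
    have [c dc Ec] := cyc ord0.
    have [_ _ c3] := dicycle_spread k2 n_big dc (etrans (esym (mul1n n)) En).
    split; first by rewrite EW0 Ec c3 mul1n.
    move=> j; rewrite (ord1 j) -EW0; apply/setP => i; rewrite inE modn1.
    by rewrite eqxx andbT.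
  case: altW => cW altW.
  case: def => [[d_gt0 _ En] cyc dis _ EW]; rewrite mul1n in En.
  have lt_dk : (d < k)%N by case/orP: dk => [/andP[/eqP->]|]; lia.
  have EnE : n = (k * (n2 + n3) + n3)%N by lia.
  have [_ Er relE] := relevant_params lt_dk EnE; have rel' := relE.1 rel.
  have NfP j : [/\ spread k (per (Nf j)), #|Nf j| = (n2 + n3)%N & #|long_ends k (Nf j)| = n3].
    by have [c dc ->] := cyc j; apply: dicycle_spread.
  (* [pred0] is a default for indices from d on, about which a family says nothing. *)
  pose B (j : nat) := oapp (fun i : 'I_d => per (Nf i)) pred0 (insub j).
  have BE (j : 'I_d) : B j = per (Nf j) by rewrite /B valK.
  have endsE (j : 'I_d) p : ends n k (B j) p = per (long_ends k (Nf j)) p.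
    by rewrite BE per_long_endsE.
  have WE p : all_ends n k d B p = per W p.
    have n_gt0 : (0 < n)%N by lia.
    rewrite (@per_ord _ _ p (Ordinal (ltn_pmod p n_gt0))) // EW.
    apply/existsP/bigcupP => [[j]|[j _]] h; exists j => //; move: h;
    by rewrite endsE (@per_ord _ _ p (Ordinal (ltn_pmod p n_gt0))).
  pose j0 := Ordinal d_gt0.
  have B0 : B 0%N = per (Nf j0) by rewrite -BE.
  have c0 : cnt (ends n k (B 0%N)) n = n3.
    by rewrite (eq_cnt (endsE j0)) cnt_per; case: (NfP j0).
  exists d, B; split.
    split.
    - by move=> j; rewrite BE; split; [apply: per_periodic | case: (NfP j)].
    - have n_gt0 : (0 < n)%N by lia.
      move=> j1 j2 p; rewrite !BE !(@per_ord _ _ p (Ordinal (ltn_pmod p n_gt0))) //.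
      move=> h1 h2; apply/eqP; apply: contraLR h2 => ne.
      by rewrite (disjointFr (dis _ _ ne) h1).
    - move=> j p lt_p; rewrite endsE -[p in per _ p]/(val (Ordinal lt_p)) per_val altW inE.
      by rewrite (eq_cnt WE) /= => /andP[_ /eqP].
    - by rewrite (eq_cnt WE) cnt_per cW dvdn_mulr.
    - by rewrite c0 /good_count rel' andbT orbC.
  rewrite c0 B0 cnt_per; case: (NfP j0) => _ -> _; rewrite -Er.
  by rewrite violatedE in viol; under eq_bigr => i _ do rewrite WE per_val.
case=> d [B [[spB disB altB dvdW goodB] lt]].
have [d_gt0 lt_dk n3_gt0] := good_count_bounds k2 goodB.
pose j0 := Ordinal d_gt0.
set n3 := cnt (ends n k (B 0%N)) n in goodB n3_gt0 lt.
have n_gt0 : (0 < n)%N by lia.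
pose Nf (j : 'I_d) := [set i : 'I_n | B j i].
have NfE j : per (Nf j) =1 B j by apply: per_set => //; case: (spB j).
have spN j : spread k (per (Nf j)).
  by move=> p; rewrite !(eq_cnt (NfE j)); case: (spB j).
have endsE j p : per (long_ends k (Nf j)) p = ends n k (B j) p.
  by rewrite per_long_endsE /ends !NfE.
have c3 j : #|long_ends k (Nf j)| = n3.
  by rewrite -cnt_per (eq_cnt (endsE j)) (@cnt_ends B d j) // /n3 (@cnt_ends B d j0).
pose q := cnt (B 0%N) n.
have Enj j : n = (k * #|Nf j| + n3)%N.
  have := spread_count k2 (@per_periodic n (Nf j)) (spN j).
  by rewrite cnt_per -card_long_ends // c3.
have cq j : #|Nf j| = q.
  have : (k * #|Nf j| = k * #|Nf j0|)%N by have := Enj j; have := Enj j0; lia.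
  move/eqP; rewrite eqn_pmul2l; last by lia.
  by move/eqP->; rewrite -cnt_per (eq_cnt (NfE j0)).
have le_q : (n3 <= q)%N.
  rewrite -(c3 j0) -(cq j0); apply: subset_leq_card; apply/subsetP => i.
  by rewrite inE => /andP[].
pose n2 := (q - n3)%N; have Eq : (n2 + n3 = q)%N by rewrite subnK.
have EnE : n = (k * (n2 + n3) + n3)%N by rewrite Eq -(cq j0).
have [En' Er relE] := relevant_params lt_dk EnE.
pose W := \bigcup_(j < d) long_ends k (Nf j).
have WE p : per W p = all_ends n k d B p.
  rewrite (@per_ord _ _ p (Ordinal (ltn_pmod p n_gt0))) //.
  apply/bigcupP/existsP => [[j _]|[j]] h; exists j => //; move: h;
  by rewrite -endsE (@per_ord _ _ p (Ordinal (ltn_pmod p n_gt0))).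
have cW : #|W| = (d * n3)%N.
  by rewrite -cnt_per (eq_cnt WE) /n3 (@cnt_ends B d j0) // mulnC divnK.
have dis (j1 j2 : 'I_d) : j1 != j2 -> [disjoint Nf j1 & Nf j2].
  move=> ne; rewrite disjoint_subset; apply/subsetP => i; rewrite !inE => h1.
  by apply: contra ne => h2; apply/eqP/(disB _ _ _ h1 h2).
have altN (j : 'I_d) : long_ends k (Nf j) = [set i in W | (cnt (per W) i %% d == j)%N].
  apply/setP => i; rewrite inE -!per_val (eq_cnt WE) WE endsE.
  apply/idP/andP => [h|[/existsP[j' h] /eqP e]].
    by split; [apply/existsP; exists j | rewrite (altB _ _ _ h)].
  by have := altB _ _ (ltn_ord i) h; rewrite e => /val_inj ->.
have rel : relevant n k d 1 n2 n3.
  by apply/relE; case/and3P: goodB => _ -> ->.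
have def : defines_minor k 1 n2 n3 Nf W.
  split=> //; first by split=> //; rewrite mul1n {1}EnE; lia.
    move=> j; have [c] := spread_dicycle k2 n_big (spN j).
    by rewrite cq c3 => dc ->; exists c.
  have cN := card_disjoint_bigcup dis cq.
  have := minor_iso_spread k2 n_big spN dis; rewrite cN muln1 Eq; apply.
  by rewrite -Eq En' subn_gt0 lt_dk /=; nia.
exists d, n2, n3, W; split; last first.
  rewrite violatedE Er Eq; apply: le_lt_trans lt.
  by rewrite le_eqVlt; apply/orP; left; apply/eqP/eq_bigr => i _; rewrite -WE per_val.
case/and3P: goodB => /orP[/andP[d2 le_d]|/andP[/eqP d1 /eqP m1]] _ _; [left|right].
  split=> //; exists Nf; split=> // j.
  by rewrite altN (alternate_set (ltn_ord j) cW).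
by split=> //; exists Nf.
Qed.

End Family.

(** * The automaton *)

(** A finite memory of a count: exact below L, and above only its residue modulo L. *)
Definition sat (L c : nat) : nat := if c < L then c else L + c %% L.

Lemma sat_add L c b : sat L (sat L c + b) = sat L (c + b).
Proof.
rewrite {2}/sat; case: ltnP => // le_L.
rewrite /sat !ltnNge -addnA leq_addr (leq_trans le_L) ?leq_addr //=.
by rewrite modnDl modnDml.
Qed.

Lemma sat_lt L c : 0 < L -> sat L c < 2 * L.
Proof.
move=> L_gt0; have lt_m := ltn_pmod c L_gt0; rewrite mul2n -addnn /sat.
by case: (ltnP c L) => h; [rewrite ltn_addr | rewrite ltn_add2l].
Qed.

Lemma sat_mod L K c : K %| L -> sat L c = c %[mod K].
Proof.
rewrite /sat; case: ltnP => // _ KL.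
by rewrite -modnDml (eqP KL) add0n modn_dvdm.
Qed.

Lemma dvdn_sat L K c : K %| L -> (K %| sat L c) = (K %| c).
Proof. by move=> KL; rewrite /dvdn sat_mod. Qed.

Lemma ceil_divS c K : 0 < K -> ceil_div c.+1 K = ceil_div c K + (K %| c).
Proof.
move=> K_gt0; rewrite /ceil_div -addnA addn_negb addn1.
have lt_r := ltn_pmod c K_gt0.
have [E|ne] := eqVneq (c %% K).+1 K.
  have -> : c.+1 = (c %/ K).+1 * K by rewrite {1}(divn_eq c K) mulSn; lia.
  by rewrite mulnK // dvdn_mull // addn0.
have lt_r1 : (c %% K).+1 < K by lia.
have -> : c.+1 = c %/ K * K + (c %% K).+1 by rewrite addnS -divn_eq.
rewrite divnMDl // (divn_small lt_r1) addn0 dvdn_addr ?dvdn_mull //.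
by rewrite gtnNdvd // addn1.
Qed.

(** Makes the ceiling a sum of local charges: an element of [E] is charged when the number of
    earlier ones is a multiple of K. *)
Lemma sum_ceil (E : pred nat) K m : 0 < K ->
  \sum_(p < m) (E p && (K %| cnt E p)) = ceil_div (cnt E m) K.
Proof.
move=> K_gt0; elim: m => [|m IH].
  by rewrite big_ord0 cnt0 /ceil_div div0n dvdn0.
rewrite big_ord_recr /= IH cntS; case: (E m) => /=; last by rewrite !addn0.
by rewrite addn1 ceil_divS.
Qed.

Lemma ceil_div_leq a b q : 0 < b -> (ceil_div a b <= q) = (a <= q * b).
Proof.
move=> b_gt0; rewrite /ceil_div {3}(divn_eq a b) /dvdn.
have := ltn_pmod a b_gt0; case: eqP => [->|ne] lt_r /=.
  by rewrite !addn0 leq_pmul2r.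
rewrite addn1; apply/idP/idP => h; first by nia.
by rewrite -(ltn_pmul2r b_gt0); lia.
Qed.

(** L = k (k - d) is a multiple of k - d and, for d = 1, of k - 1, so the residues survive. For 0 <
    d < k the ceilings differ strictly from L on, as L adds k - d to one and k to the other. *)
Lemma good_count_sat k d c : 2 <= k -> good_count k d (sat (k * (k - d)) c) = good_count k d c.
Proof.
(* If k <= d then L = 0, and [sat 0] is the identity. *)
move=> k2; have [le_kd|lt_dk] := leqP k d.
  by rewrite (eqP le_kd) muln0 /sat /= modn0.
rewrite /good_count dvdn_sat ?dvdn_mull //.
have [->|d_gt0] := posnP d; first by [].
have -> : (d == 1) && (sat (k * (k - d)) c == 1 %[mod k.-1]) =
          (d == 1) && (c == 1 %[mod k.-1]).
  by case: (eqVneq d 1) => [->|//]; rewrite sat_mod // subn1 dvdn_mull.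
congr [&& _, _ & _]; rewrite /sat; case: (ltnP c) => // le_L.
have large r : ceil_div (k * (k - d) + r) k < ceil_div (k * (k - d) + r) (k - d).
  rewrite ceil_div_MDl; last by lia.
  rewrite mulnC ceil_div_MDl; last by lia.
  have h : ceil_div r k <= ceil_div r (k - d).
    rewrite ceil_div_leq; last by lia.
    have : ceil_div r (k - d) <= ceil_div r (k - d) by [].
    by rewrite ceil_div_leq => [|]; nia.
  by lia.
by rewrite large -(subnKC le_L) large.
Qed.

Section Automaton.
Variable k : nat.
Hypothesis k2 : 2 <= k.

(* The number d of cycles; for each cycle, the distance back to its last vertex;
   the number of elements of W seen so far, modulo d; the number of elements of
   W^0 seen so far, through sat. *)
Definition astate : finType :=
  ('I_k.+1 * {ffun 'I_k.+1 -> 'I_k.+1} * 'I_k.+1 * 'I_(2 * (k * k)).+1)%type.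

Implicit Types q : astate.

Definition cycles q : nat := q.1.1.1.
Definition age q (j : nat) : nat := q.1.1.2 (inord j).
Definition rank_mod q : nat := q.1.2.
Definition count_sat q : nat := q.2.

(** A step from q to q' reads one position: a cycle visits it when its new age is 0, through an arc
    of length k+1 when its old age was k. *)
Definition visit q' (j : nat) : bool := age q' j == 0.
Definition long_visit q q' (j : nat) : bool := visit q' j && (age q j == k).
Definition some_long_visit q q' : bool :=
  [exists j : 'I_k.+1, (j < cycles q) && long_visit q q' j].

(** Ages live in ['I_k.+1], so age k forces a visit; as visits need age at least k - 1, the gaps are
    k and k+1. The rank is tested before its update, since it counts the elements of W strictly
    before the position. *)
Definition atrans q q' : bool :=
  [&& cycles q' == cycles q,
      [forall j : 'I_k.+1, (j < cycles q) ==>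
         ((age q' j == (age q j).+1) || (visit q' j && (k.-1 <= age q j)))],
      [forall j1 : 'I_k.+1, forall j2 : 'I_k.+1,
         [&& j1 < cycles q, j2 < cycles q, visit q' j1 & visit q' j2] ==> (j1 == j2)],
      [forall j : 'I_k.+1, (j < cycles q) && long_visit q q' j ==> (rank_mod q == j)],
      rank_mod q' == (rank_mod q + some_long_visit q q') %% cycles q
    & count_sat q' ==
        sat (k * (k - cycles q)) (count_sat q + long_visit q q' 0)].

(** Equal ages at both ends close the scan around the circle; the rank counter returning to 0 says
    that d divides the size of W. *)
Definition aaccept q0 q : bool :=
  [&& q0.1.1.2 == q.1.1.2, rank_mod q0 == 0, rank_mod q == 0, count_sat q0 == 0
    & good_count k (cycles q0) (count_sat q)].

Definition aweight q q' : nat := 1 + some_long_visit q q'.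
(** The visits of cycle 0 add up to n2 + n3 and the second term to the ceiling of n3 / (k - d),
    which together make the right-hand side. *)
Definition acost q q' : nat :=
  visit q' 0 + (long_visit q q' 0 && (k - cycles q %| count_sat q)).

(** * Runs that follow a family of periodic sets *)

Section Run.
Variables (n d : nat) (B : nat -> pred nat) (t : nat -> nat -> nat) (w : nat -> astate).
Hypotheses (n_big : k.+2 <= n) (d_gt0 : 0 < d) (lt_dk : d < k).
Hypothesis perB : forall j : 'I_d, periodic n (B j).
Hypothesis perT : forall (j : 'I_d) p, t j (p + n) = t j p.
Hypothesis timB : forall j : 'I_d, timed k (B j) (t j).
Hypothesis cyc_w : forall p, p <= n -> cycles (w p) = d.
Hypothesis age_w : forall p (j : 'I_d), p <= n -> age (w p) j = t j p.

Let j0 := Ordinal d_gt0.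

Lemma visit_run (j : 'I_d) p : p < n -> visit (w p.+1) j = B j p.
Proof.
move=> lt_p; rewrite /visit age_w //; case: (timB j) => -> _ _.
by case: (B j p).
Qed.

Lemma long_visit_run (j : 'I_d) p :
  p < n -> long_visit (w p) (w p.+1) j = ends n k (B j) p.
Proof.
move=> lt_p; rewrite /long_visit visit_run // age_w ?(ltnW lt_p) //.
have := timed_long (p + n - k.+1) k2 (timB j).
rewrite /long subnK; last by rewrite (leq_trans (ltnW n_big)) ?leq_addl.
by rewrite perB perT => ->; rewrite /ends andbC.
Qed.

Lemma some_long_visit_run p :
  p < n -> some_long_visit (w p) (w p.+1) = all_ends n k d B p.
Proof.
move=> lt_p; rewrite /some_long_visit cyc_w ?(ltnW lt_p) //.
apply/existsP/existsP => [[j /andP[lt_j]]|[j]].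
  by rewrite (long_visit_run (Ordinal lt_j)) //; exists (Ordinal lt_j).
rewrite -long_visit_run // => h.
have lt_j : j < k.+1 := leq_trans (ltn_ord j) (leqW (ltnW lt_dk)).
by exists (Ordinal lt_j); rewrite /= ltn_ord.
Qed.

Lemma run_weight (R : realType) (x : 'rV[R]_n) :
  (forall p, p <= n -> count_sat (w p) = sat (k * (k - d)) (cnt (ends n k (B 0)) p)) ->
  ((\sum_(i < n) (x 0 i *+ aweight (w i) (w i.+1) - (acost (w i) (w i.+1))%:R) < 0)
   = (\sum_(i < n) x 0 i *+ (1 + all_ends n k d B i) <
      (cnt (B 0%N) n + ceil_div (cnt (ends n k (B 0%N)) n) (k - d))%:R))%R.
Proof.
move=> sat_w; rewrite sumrB subr_lt0 -natr_sum; congr (_ < _%:R)%R.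
  by apply: eq_bigr => i _; rewrite /aweight some_long_visit_run.
rewrite -sum_ceil ?subn_gt0 //.
rewrite /cnt -big_split /=; apply: eq_bigr => i _.
rewrite /acost (visit_run j0) // (long_visit_run j0) // cyc_w ?(ltnW (ltn_ord i)) //.
by rewrite sat_w ?(ltnW (ltn_ord i)) // dvdn_sat ?dvdn_mull.
Qed.

End Run.

Lemma family_walk (R : realType) n (x : 'rV[R]_n) : k.+2 <= n ->
  (exists d B, alternating_family n k d B /\
    \sum_(i < n) x 0 i *+ (1 + all_ends n k d B i) <
    (cnt (B 0%N) n + ceil_div (cnt (ends n k (B 0%N)) n) (k - d))%:R)%R ->
  exists w : nat -> astate, [/\ aaccept (w 0) (w n),
    forall i, i < n -> atrans (w i) (w i.+1)
    & (\sum_(i < n) (x 0 i *+ aweight (w i) (w i.+1) - (acost (w i) (w i.+1))%:R) < 0)%R].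
Proof.
move=> n_big [d [B [[spB disB altB dvdW goodB] lt]]].
have [d_gt0 lt_dk _] := good_count_bounds k2 goodB.
have tim_ex (j : 'I_d) : exists t, timed k (B j) t /\ forall p, t (p + n) = t p.
  by have [perB sp] := spB j; have [t] := spread_timed k2 n_big perB sp; exists t.
have [t0 t0P] := fin_all_exists tim_ex.
(* Ages for indices from d on are constantly 0, so they too agree at both ends. *)
pose t (j : nat) := oapp t0 (fun=> 0) (insub j).
have tE (j : 'I_d) : t j = t0 j by rewrite /t valK.
have tim (j : 'I_d) : timed k (B j) (t j) by rewrite tE; case: (t0P j).
have perT (j : 'I_d) p : t j (p + n) = t j p by rewrite tE; case: (t0P j).
pose L := k * (k - d).
have L_gt0 : 0 < L by rewrite muln_gt0; lia.
pose w p : astate := (inord d, [ffun j : 'I_k.+1 => inord (t j p)],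
  inord (cnt (all_ends n k d B) p %% d), inord (sat L (cnt (ends n k (B 0)) p))).
have cyc_w p : cycles (w p) = d by rewrite /cycles inordK //; lia.
have ltjk (j : 'I_d) : j < k.+1 by have := ltn_ord j; lia.
have age_w p (j : 'I_d) : age (w p) j = t j p.
  rewrite /age ffunE !inordK // ?ltnS ?inordK //; by case: (tim j).
have rank_w p : rank_mod (w p) = cnt (all_ends n k d B) p %% d.
  by rewrite /rank_mod inordK //; have := ltn_pmod (cnt (all_ends n k d B) p) d_gt0; lia.
have sat_w p : count_sat (w p) = sat L (cnt (ends n k (B 0)) p).
  rewrite /count_sat inordK //; have := sat_lt (cnt (ends n k (B 0)) p) L_gt0.
  by rewrite /L; nia.
have perB (j : 'I_d) : periodic n (B j) by case: (spB j).
have visE := @visit_run n d B t w tim (fun p j _ => age_w p j).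
have lvE := @long_visit_run n d B t w n_big perB perT tim (fun p j _ => age_w p j).
have slvE := @some_long_visit_run n d B t w n_big lt_dk perB perT tim
  (fun p _ => cyc_w p) (fun p j _ => age_w p j).
pose j0 := Ordinal d_gt0.
exists w; split.
- apply/and5P; split; rewrite ?rank_w ?sat_w ?cnt0 ?mod0n ?cyc_w //.
  + apply/eqP/ffunP => j; rewrite !ffunE; congr inord.
    have [lt_j|ge_j] := ltnP j d; last by rewrite /t insubF // ltnNge ge_j.
    by rewrite -[n]add0n (perT (Ordinal lt_j)).
  + by rewrite /sat L_gt0.
  + by rewrite good_count_sat.
- move=> p lt_p; apply/and5P; split; last (apply/andP; split); rewrite ?cyc_w ?rank_w ?sat_w //.
  + apply/forallP => j; apply/implyP => lt_j.
    rewrite (visE (Ordinal lt_j)) // !(age_w _ (Ordinal lt_j)).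
    case: (tim (Ordinal lt_j)) => /(_ p) -> _ /(_ p).
    by case: (B _ p) => /= [->|_]; rewrite ?orbT ?eqxx.
  + apply/forallP => j1; apply/forallP => j2; apply/implyP => /and4P[lt1 lt2].
    rewrite (visE (Ordinal lt1)) // (visE (Ordinal lt2)) // => h1 h2.
    by have [e] := disB (Ordinal lt1) (Ordinal lt2) p h1 h2; apply/eqP/val_inj.
  + apply/forallP => j; apply/implyP => /andP[lt_j].
    by rewrite (lvE (Ordinal lt_j)) // => /altB ->.
  + by rewrite slvE // cntS modnDml.
  + by rewrite (lvE j0) // cntS sat_add.
by rewrite (@run_weight n d B t w n_big d_gt0 lt_dk perB perT tim
  (fun p _ => cyc_w p) (fun p j _ => age_w p j)).
Qed.

Lemma walk_family (R : realType) n (x : 'rV[R]_n) : k.+2 <= n ->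
  (exists w : nat -> astate, [/\ aaccept (w 0) (w n),
    forall i, i < n -> atrans (w i) (w i.+1)
    & (\sum_(i < n) (x 0 i *+ aweight (w i) (w i.+1) - (acost (w i) (w i.+1))%:R) < 0)%R]) ->
  exists d B, alternating_family n k d B /\
    (\sum_(i < n) x 0 i *+ (1 + all_ends n k d B i) <
    (cnt (B 0%N) n + ceil_div (cnt (ends n k (B 0%N)) n) (k - d))%:R)%R.
Proof.
move=> n_big [w [acc_w tr_w lt]].
case/and5P: acc_w => /eqP age_n /eqP rk0 /eqP rkn /eqP sat0 goodn.
set d := cycles (w 0) in goodn.
have [d_gt0 lt_dk _] := good_count_bounds k2 goodn.
have n_gt0 : 0 < n by lia.
have cyc_w p : p <= n -> cycles (w p) = d.
  elim: p => // p IH lt_p; have /and5P[/eqP -> _ _ _ _] := tr_w p lt_p.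
  by apply: IH; apply: ltnW.
have ltjk (j : 'I_d) : j < k.+1 by have := ltn_ord j; lia.
(* The run is extended periodically; this is consistent because [w n] and [w 0] have the same ages
   by acceptance. *)
pose t j p := age (w (p %% n)) j.
have age_w p (j : 'I_d) : p <= n -> age (w p) j = t j p.
  rewrite leq_eqVlt /t => /orP[/eqP->|lt_p]; last by rewrite modn_small.
  by rewrite modnn /age age_n.
have tS j p : t j p.+1 = age (w (p %% n).+1) j.
  rewrite /t -addn1 -modnDml addn1.
  have : (p %% n).+1 <= n by rewrite ltn_pmod.
  rewrite leq_eqVlt => /orP[/eqP->|lt_p]; last by rewrite modn_small.
  by rewrite modnn /age age_n.
(* A visit at p shows in the state after p, so the index ranges from 1 to n. *)
pose B j p := visit (w (p %% n).+1) j.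
have tim (j : 'I_d) : timed k (B j) (t j).
  have tr p : (t j p.+1 == (t j p).+1) || (B j p && (k.-1 <= t j p)).
    have lt_p := ltn_pmod p n_gt0; have /and5P[_ h _ _ _] := tr_w _ lt_p.
    have := implyP (forallP h (Ordinal (ltjk j))); rewrite cyc_w ?(ltnW lt_p) //.
    by rewrite tS; move/(_ (ltn_ord j)).
  have BE p : B j p = (t j p.+1 == 0) by rewrite tS.
  split=> [p|p|p Bp].
  - by have := tr p; rewrite BE; case: (t j p.+1 =P 0) => //= _; rewrite orbF => /eqP.
  - by rewrite -ltnS /t; apply: ltn_ord.
  - by have := tr p; rewrite Bp; move: Bp; rewrite BE => /eqP ->.
have perB (j : 'I_d) : periodic n (B j) by move=> p; rewrite /B modnDr.
have perT (j : 'I_d) p : t j (p + n) = t j p by rewrite /t modnDr.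
have lvE := @long_visit_run n d B t w n_big perB perT tim age_w.
have slvE := @some_long_visit_run n d B t w n_big lt_dk perB perT tim cyc_w age_w.
pose j0 := Ordinal d_gt0.
have rank_w p : p <= n -> rank_mod (w p) = cnt (all_ends n k d B) p %% d.
  elim: p => [|p IH] lt_p; first by rewrite rk0 cnt0 mod0n.
  have /and5P[_ _ _ _ /andP[/eqP -> _]] := tr_w p lt_p.
  by rewrite slvE // cyc_w ?(ltnW lt_p) // IH ?(ltnW lt_p) // cntS modnDml.
have sat_w p : p <= n -> count_sat (w p) = sat (k * (k - d)) (cnt (ends n k (B 0)) p).
  elim: p => [|p IH] lt_p.
    by rewrite sat0 cnt0 /sat muln_gt0 subn_gt0 lt_dk; case: (k) k2.
  have /and5P[_ _ _ _ /andP[_ /eqP ->]] := tr_w p lt_p.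
  by rewrite (lvE j0) // cyc_w ?(ltnW lt_p) // IH ?(ltnW lt_p) // cntS sat_add.
exists d, B; split; last first.
  by rewrite -(@run_weight n d B t w n_big d_gt0 lt_dk perB perT tim cyc_w age_w).
split.
- by move=> j; split=> //; apply: timed_spread (tim j).
- move=> j1 j2 p; rewrite /B => h1 h2.
  have lt_p := ltn_pmod p n_gt0; have /and5P[_ _ h _ _] := tr_w _ lt_p.
  have := forallP (forallP h (Ordinal (ltjk j1))) (Ordinal (ltjk j2)).
  rewrite cyc_w ?(ltnW lt_p) //= !ltn_ord h1 h2 /= => /eqP[e].
  exact: val_inj.
- move=> j p lt_p; rewrite -lvE // => h.
  have /and5P[_ _ _ h' _] := tr_w _ lt_p.
  have := forallP h' (Ordinal (ltjk j)).
  by rewrite cyc_w ?(ltnW lt_p) //= ltn_ord h /= rank_w ?(ltnW lt_p) // => /eqP.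
- by rewrite /dvdn -rank_w // rkn.
- by rewrite -good_count_sat // -sat_w.
Qed.

End Automaton.

Theorem theorem4p15 (R : realType) (k : nat) (hk : 2 <= k) :
  decidable_in_poly_time (R := R) k.+2
    (fun n x => violates_alternated_minor k x).
Proof.
have [c [p cP]] := walk_decidable R (@atrans k) (@aaccept k) (@aweight k) (@acost k) k.+2.
exists c, p => n x n_big; have [t [s [ex le_t iff_s]]] := cP n x n_big.
exists t, s; split=> //; rewrite iff_s violates_family //.
by split; [apply: walk_family | apply: family_walk].
Qed.
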